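(* Let $X=(X_n:n\ge0)$ be a one-dimensional (real-valued, not killed) random walk with $X_0=0$ and step $X_1$, where $X_1$ is not identically zero. Let $H^+$ and $H^{-,w}$ be the first steps of the strict ascending and weak descending ladder height processes of $X$: with $$\tau^+=\inf\{n\ge1:X_n>0\},\qquad \tau^{-,w}=\inf\{n\ge1:X_n\le0\},$$ $H^+=X_{\tau^+}$ on $\{\tau^+<\infty\}$ and $H^+=\Delta$ otherwise; $H^{-,w}=-X_{\tau^{-,w}}$ on $\{\tau^{-,w}<\infty\}$ and $H^{-,w}=\Delta$ otherwise. If $V^+$ is a positive defective random variable and $V^-$ is a non-negative defective random variable satisfying $$1-\mathbb{E}\bigl[e^{\mathrm{i}zX_1}\bigr]=\Bigl(1-\mathbb{E}\bigl[e^{\mathrm{i}zV^+}\bigr]\Bigr)\Bigl(1-\mathbb{E}\bigl[e^{-\mathrm{i}zV^-}\bigr]\Bigr),\qquad z\in\mathbb{R},$$ then $V^+\overset{d}{=}H^+$ and $V^-\overset{d}{=}H^{-,w}$.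
   Context: $\Delta$ is a cemetery state adjoined to $\mathbb{R}$; any function $f\colon\mathbb{R}\to\mathbb{C}$ is extended by $f(\Delta)=0$, so that, e.g., $\mathbb{E}[e^{\mathrm{i}zV^+}]=\mathbb{E}[e^{\mathrm{i}zV^+};V^+\ne\Delta]$. A positive (resp. non-negative) defective random variable is a random variable with values in $(0,\infty)\cup\{\Delta\}$ (resp. $[0,\infty)\cup\{\Delta\}$). The symbol $\overset{d}{=}$ denotes equality in distribution. *)

(* Defs.v *)
From HB Require Import structures.
From mathcomp Require Import all_boot all_order all_algebra.
From mathcomp Require Import finmap.
From mathcomp Require Import all_classical all_reals all_analysis.
From mathcomp Require Import measurable_realfun.
From mathcomp Require Import complex.

Set Implicit Arguments.
Unset Strict Implicit.
Unset Printing Implicit Defensive.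

Import Order.TTheory GRing.Theory Num.Theory.
Import numFieldNormedType.Exports.

Local Open Scope classical_set_scope.
Local Open Scope ring_scope.

(* The state space T with a cemetery state, [None], adjoined as an isolated
   measurable point: a set is measurable iff its trace on T is. *)
Definition killed (T : Type) : Type := option T.

Definition Delta {T : Type} : killed T := None.

Definition killed_measurable d (T : measurableType d) : set (set (killed T)) :=
  [set A | measurable ((Some : T -> killed T) @^-1` A)].

Definition killed_display (d : measure_display) : measure_display.
Proof. exact. Qed.

HB.instance Definition _ (T : choiceType) := Choice.copy (killed T) (option T).
HB.instance Definition _ (T : choiceType) :=
  isPointed.Build (killed T) Delta.

Section killed_measurableType.
Context d (T : measurableType d).

Let killed_measurable0 : killed_measurable (set0 : set (killed T)).
Proof. by rewrite /killed_measurable /= preimage_set0. Qed.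

Let killed_measurableC (A : set (killed T)) :
  killed_measurable A -> killed_measurable (~` A).
Proof. by rewrite /killed_measurable /= preimage_setC; exact: measurableC. Qed.

Let killed_measurable_bigcup (F : (set (killed T))^nat) :
  (forall i, killed_measurable (F i)) -> killed_measurable (\bigcup_i F i).
Proof.
move=> mF; rewrite /killed_measurable /= preimage_bigcup.
by apply: bigcup_measurable => i _; exact: mF.
Qed.

HB.instance Definition _ := isMeasurable.Build (killed_display d) (killed T)
  killed_measurable0 killed_measurableC killed_measurable_bigcup.

End killed_measurableType.

Definition kill_ext (R : realType) (f : R -> R[i]) (v : killed R) : R[i] :=
  if v is Some x then f x else 0.

Section defective.
Context d (Omega : measurableType d) (R : realType) (P : probability Omega R).

Definition positive_defective (V : {RV P >-> killed R}) : Prop :=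
  forall w, V w = Delta \/ exists2 x, 0 < x & V w = Some x.

Definition nonnegative_defective (V : {RV P >-> killed R}) : Prop :=
  forall w, V w = Delta \/ exists2 x, 0 <= x & V w = Some x.

End defective.

(* [expi t] is e^(i t) for real t. *)
Definition expi (R : realType) (t : R) : R[i] := (cos t +i* sin t)%C.

(* Meaningful for measurable f with integrable real and imaginary parts,
   in particular for bounded measurable f. *)
Definition Cexpectation d (Omega : measurableType d) (R : realType)
    (P : probability Omega R) (f : Omega -> R[i]) : R[i] :=
  (fine 'E_P[fun w => complex.Re (f w)] +i* fine 'E_P[fun w => complex.Im (f w)])%C.

Definition eq_dist d1 d2 d' (O1 : measurableType d1) (O2 : measurableType d2)
    (T : measurableType d') (R : realType)
    (P : probability O1 R) (Q : probability O2 R)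
    (X : {RV P >-> T}) (Y : {RV Q >-> T}) : Prop :=
  forall A : set T, measurable A -> distribution P X A = distribution Q Y A.
Arguments eq_dist {d1 d2 d' O1 O2 T R} P Q X Y.

Definition mutually_independent d d' (Omega : measurableType d)
    (T : measurableType d') (R : realType) (P : probability Omega R)
    (xi : nat -> {RV P >-> T}) : Prop :=
  forall (J : {fset nat}) (B : nat -> set T), (forall i, measurable (B i)) ->
    P (\bigcap_(i in [set` J]) (xi i @^-1` B i))
    = (\prod_(i <- J) P (xi i @^-1` B i))%E.

Section random_walk.
Context d (Omega : measurableType d) (R : realType) (P : probability Omega R).
Variable X : nat -> {RV P >-> R}.

Definition increment (n : nat) : {RV P >-> R} := X n.+1 - X n.

Definition random_walk : Prop :=
  [/\ forall w, X 0%N w = 0,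
      mutually_independent increment
    & forall n, eq_dist P P (increment n) (increment 0)].

End random_walk.

(* Infimum of a set of times; [None] encodes inf of the empty set, i.e. +oo. *)
Definition first_time (p : pred nat) : option nat :=
  if pselect (exists n, p n) is left e then Some (ex_minn e) else None.

Lemma first_time_Some (p : pred nat) n :
  first_time p = Some n <-> p n /\ forall k, (k < n)%N -> ~~ p k.
Proof.
rewrite /first_time; case: pselect => [e|ne]; last first.
  by split=> // -[pn _]; case: ne; exists n.
case: ex_minnP => m pm min_m; split=> [[<-]|[pn lt_n]].
  by split=> // k; rewrite ltnNge; apply: contra => /min_m.
congr Some; apply/eqP; rewrite eqn_leq min_m //= leqNgt.
by apply/negP => /lt_n; rewrite pm.
Qed.

Lemma first_time_None (p : pred nat) :
  first_time p = None <-> forall n, ~~ p n.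
Proof.
rewrite /first_time; case: pselect => [[n pn]|ne]; split=> //.
  by move=> /(_ n); rewrite pn.
by move=> _ n; apply/negP => pn; apply: ne; exists n.
Qed.

Section ladder.
Context d (Omega : measurableType d) (R : realType) (P : probability Omega R).
Variable X : nat -> {RV P >-> R}.

Definition tau_plus (w : Omega) : option nat :=
  first_time [pred n | (1 <= n)%N & 0 < X n w].

Definition tau_minus_weak (w : Omega) : option nat :=
  first_time [pred n | (1 <= n)%N & X n w <= 0].

Definition H_plus (w : Omega) : killed R :=
  if tau_plus w is Some n then Some (X n w) else Delta.

Definition H_minus_weak (w : Omega) : killed R :=
  if tau_minus_weak w is Some n then Some (- X n w) else Delta.

Let measurable_stopped (p : Omega -> pred nat) (Y : nat -> Omega -> R) :
  (forall n, measurable_fun setT (Y n)) ->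
  (forall n, measurable [set w | p w n]) ->
  measurable_fun setT (fun w : Omega =>
    (if first_time (p w) is Some n then Some (Y n w) else Delta) : killed R).
Proof.
move=> mY mp _ A mA; rewrite setTI.
have mpC n : measurable [set w | ~~ p w n].
  rewrite (_ : [set w | _] = ~` [set w | p w n]); first exact: measurableC.
  by apply/seteqP; split=> w /= /negP.
pose E n := [set w | p w n] `&` \bigcap_(k in [set k | (k < n)%N])
  [set w | ~~ p w k].
have mE n : measurable (E n).
  by apply: measurableI => //; apply: bigcap_measurableType.
have mYA n : measurable (Y n @^-1` (Some @^-1` A)).
  by rewrite -[X in measurable X]setTI; exact: mY.
pose F := if `[< A Delta >] then \bigcap_n [set w | ~~ p w n] else set0.
have mF : measurable F.
  by rewrite /F; case: asbool => //; apply: bigcapT_measurable.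
rewrite (_ : _ @^-1` A =
    (\bigcup_n (E n `&` Y n @^-1` (Some @^-1` A))) `|` F).
  apply: measurableU => //; apply: bigcup_measurable => n _.
  exact: measurableI.
apply/seteqP; split=> w /=.
  case: (first_time (p w)) (first_time_Some (p w)) (first_time_None (p w)).
    by move=> n /(_ n) [/(_ erefl)[pn ltn] _] _ AY; left; exists n.
  by move=> _ [/(_ erefl) np _] AD; right; rewrite /F asboolT // => n _; exact: np.
case=> [[n _ [[pn ltn] AY]]|].
  by have /first_time_Some -> : p w n /\ forall k, (k < n)%N -> ~~ p w k.
rewrite /F; case: asboolP => // AD np.
by have /first_time_None -> : forall n, ~~ p w n by move=> n; exact: np.
Qed.

Let measurable_H_plus : measurable_fun setT H_plus.
Proof.
apply: (measurable_stopped (p := fun w => [pred n | (1 <= n)%N & 0 < X n w])).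
  by move=> n; exact: measurable_funPT.
move=> [|n] /=; first by rewrite set_false.
rewrite (_ : [set w | _] = X n.+1 @^-1` `]0, +oo[).
  by rewrite -[X in measurable X]setTI; exact: measurable_funPT.
by apply/seteqP; split=> w /=; rewrite in_itv /= andbT.
Qed.

Let measurable_H_minus_weak : measurable_fun setT H_minus_weak.
Proof.
apply: (measurable_stopped (p := fun w => [pred n | (1 <= n)%N & X n w <= 0])
  (Y := fun n w => - X n w)).
  by move=> n; exact: measurable_funN.
move=> [|n] /=; first by rewrite set_false.
rewrite (_ : [set w | _] = X n.+1 @^-1` `]-oo, 0]).
  by rewrite -[X in measurable X]setTI; exact: measurable_funPT.
by apply/seteqP; split=> w /=; rewrite in_itv.
Qed.

HB.instance Definition _ :=
  isMeasurableFun.Build _ _ _ _ H_plus measurable_H_plus.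
HB.instance Definition _ :=
  isMeasurableFun.Build _ _ _ _ H_minus_weak measurable_H_minus_weak.

End ladder.

(* Main.v *)
Require Import Defs.
From HB Require Import structures.
From mathcomp Require Import all_boot all_order all_algebra.
From mathcomp Require Import finmap.
From mathcomp Require Import all_classical all_reals all_analysis.
From mathcomp Require Import measurable_realfun.
From mathcomp Require Import complex.
From mathcomp Require Import ring lra.

Set Implicit Arguments.
Unset Strict Implicit.
Unset Printing Implicit Defensive.

Import Order.TTheory GRing.Theory Num.Theory.
Import numFieldNormedType.Exports.

Local Open Scope classical_set_scope.
Local Open Scope ring_scope.

(** Let F, p, q, h, g be the Fourier transforms of the laws of X_1, V^+, - V^-,
    H^+ and - H^{-,w}, the cemetery being left out.  Then p and h come from
    finite measures carried by the half-line A = ]0, +oo[, q and g from measures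
    carried by ~` A = ]-oo, 0], and the hypothesis is (1 - p) (1 - q) = 1 - F.
    A finite measure is determined by its transform ([cft_inj]), so the claim
    amounts to p = h and q = g.

    Both half-lines are closed under addition.  Hence the transforms carried by
    A and those carried by ~` A are two families closed under sums and products,
    and each transform is the sum of one member of each family in exactly one
    way ([carried_splitting]).  This structure, isolated in [splitting], is all
    that the algebra below uses.

    Domination.  Let s_n be the transform of X_n on {X_1, ..., X_n in A} and e_n
    that of X_(n+1) at an exit from A at time n+1.  Independence of increments
    gives s_n F = s_(n+1) + e_n ([walk_exits]), and the e_n sum to g.  The sums
    of powers of p satisfy the same recursion up to a positive error, and
    comparing the parts carried by ~` A shows that q - (e_0 + ... + e_(N-1)) is
    the transform of a measure ([exits_minorant]).  So the law of - V^- dominates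
    that of - H^{-,w}; exchanging the half-lines, the law of V^+ dominates that
    of H^+.

    Wiener-Hopf factorisation.  The ladder variables factor 1 - F as well.  The
    classical proof reverses the path; here the recursions of the walk kept in A
    and of the walk kept in ~` A are multiplied together, and uniqueness of the
    splitting yields the renewal equation of each ([exits_renewal]).  Termwise
    convolution identities follow, and sum to F + h g = h + g
    ([cauchy_product]).

    Rigidity.  Subtracting the two factorisations gives
    (p - h) (1 - g) + (1 - p) (q - g) = 0.  At z = 0 all four factors are
    nonnegative reals, so both products vanish there.  If V^+ and H^+ had
    different total masses, then g(0) = 1, so q = g by domination, and
    (p - h) (1 - g) = 0 everywhere.  As p - h does not vanish near 0, g = 1 near
    0, hence everywhere ([cft_eq1]), and X_1 would be 0 almost surely.  So p = h;
    in the same way q <> g would force h = 1, impossible on ]0, +oo[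
    ([factors_eq]). *)

(** * Wiener-Hopf algebra over a ring with two complementary families *)

Section splitting.
Variable K : comNzRingType.
Implicit Types (cA cB : K -> Prop) (F : K) (g b a : nat -> K).

(** The model is the ring of functions R -> R[i]: pos is the family of transforms
    of finite measures, cA and cB those of measures carried by a set and by its
    complement. *)
Record splitting (pos cA cB : K -> Prop) : Prop := Splitting {
  posD : forall f h, pos f -> pos h -> pos (f + h);
  posM : forall f h, pos f -> pos h -> pos (f * h);
  split0l : cA 0;
  splitDl : forall f h, cA f -> cA h -> cA (f + h);
  splitMl : forall f h, cA f -> cA h -> cA (f * h);
  splitWl : forall f, cA f -> pos f;
  split0r : cB 0;
  splitDr : forall f h, cB f -> cB h -> cB (f + h);
  splitMr : forall f h, cB f -> cB h -> cB (f * h);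
  splitWr : forall f, cB f -> pos f;
  splitE : forall f, pos f -> exists u v, [/\ cA u, cB v & f = u + v];
  split_uniq : forall u u' v v', cA u -> cA u' -> cB v -> cB v' ->
    u + v = u' + v' -> u = u' }.

Lemma splittingC pos cA cB : splitting pos cA cB -> splitting pos cB cA.
Proof.
case=> ? ? ? ? ? ? ? ? ? ? sE uniq; split=> //.
  by move=> f /sE[a [b [? ? ->]]]; exists b, a; split=> //; rewrite addrC.
move=> b b' a a' Bb Bb' Aa Aa' e; have e' : a + b = a' + b' by rewrite addrC e addrC.
by have aa := uniq _ _ _ _ Aa Aa' Bb Bb' e'; move: e; rewrite aa => /addIr.
Qed.

Lemma split_sum pos cA cB (I : Type) (r : seq I) (P : pred I) (f : I -> K) :
  splitting pos cA cB -> (forall i, P i -> cA (f i)) -> cA (\sum_(i <- r | P i) f i).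
Proof. by move=> S Af; apply: big_ind => //; [exact: split0l S|exact: splitDl S]. Qed.

(** For a walk killed when it leaves a set, g n stands for the law of the n-th
    position before the exit and b n for the law of the exit position when the
    exit takes place at step n.+1. *)
Definition exits cA cB F g b :=
  [/\ g 0%N = 1, forall n, g n * F = g n.+1 + b n,
      forall n, cA (g n.+1) & forall n, cB (b n)].

(** The partial Green sums G = g_0 + ... + g_m satisfy G F = (next G) - 1 + exits,
    while the sums U of powers of p satisfy U F = (next U) - 1 + q up to the
    positive term p ^ (m+1) q.  Comparing the two cA-parts shows by induction
    that U - G stays positive; the cB-parts then bound the exits by q.  Finite
    sums are enough, so no renewal measure of infinite mass appears. *)
Lemma exits_minorant pos cA cB F p q g b N :
  splitting pos cA cB -> pos F -> cA p -> cB q -> F + p * q = p + q ->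
  exits cA cB F g b -> cB (q - \sum_(n < N) b n).
Proof.
move=> S posF Ap Bq eF [g0 gS Ag Bb].
pose U N := \sum_(n < N.+1) p ^+ n; pose G N := \sum_(n < N.+1) g n.
have ApX n : cA (p ^+ n.+1).
  by elim: n => [|n IHn]; rewrite ?expr1// exprS; exact: (splitMl S).
have AU m : cA (U m - 1).
  rewrite /U big_ord_recl expr0 addrAC subrr add0r.
  by apply: (split_sum _ S) => i _; exact: ApX.
have AG m : cA (G m - 1).
  rewrite /G big_ord_recl g0 addrAC subrr add0r.
  by apply: (split_sum _ S) => i _; exact: Ag.
have UF m : U m * F + p ^+ m.+1 * q = U m.+1 - 1 + q.
  have Up : (1 - p) * U m = 1 - p ^+ m.+1.
    by rewrite -[RHS]opprB subrX1 -mulNr opprB.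
  have -> : U m.+1 = U m + p ^+ m.+1 by rewrite /U big_ord_recr.
  have -> : F = p + q - p * q by rewrite -eF addrK.
  have -> : U m * (p + q - p * q) = U m - (1 - p) * U m * (1 - q) by ring.
  by rewrite Up; ring.
have GF m : G m * F = G m.+1 - 1 + \sum_(n < m.+1) b n.
  rewrite /G mulr_suml (eq_bigr (fun n : 'I__ => g n.+1 + b n)) => [|n _]; last exact: gS.
  by rewrite big_split /= [in RHS]big_ord_recl g0 /=; ring.
have step m : cA (U m - G m) ->
    cA (U m.+1 - G m.+1) /\ cB (q - \sum_(n < m.+1) b n).
  move=> AD.
  have : pos ((U m - G m) * F + p ^+ m.+1 * q).
    apply: (posD S); apply: (posM S) => //; [exact: (splitWl S)|
      by apply: (splitWl S); exact: ApX|exact: (splitWr S)].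
  move=> /(splitE S)[x [y [Ax By exy]]].
  have e : (G m.+1 - 1 + x) + (\sum_(n < m.+1) b n + y) = (U m.+1 - 1) + q.
    by rewrite -UF addrACA -exy -GF; ring.
  have By' : cB (\sum_(n < m.+1) b n + y).
    by apply: (splitDr S) => //; apply: (split_sum _ (splittingC S)) => i _; exact: Bb.
  have Ax' := splitDl S (AG m.+1) Ax.
  have e1 := split_uniq S Ax' (AU m.+1) By' Bq e.
  move: e; rewrite e1 => /addrI e2; split.
    have -> : U m.+1 - G m.+1 = x; last by [].
    by rewrite -[U _](subrK 1) -e1; ring.
  by rewrite -e2 addrAC subrr add0r.
have AD m : cA (U m - G m).
  elim: m => [|n IHn]; last by case: (step _ IHn).
  by rewrite /U /G !big_ord_recl !big_ord0 g0 expr0 subrr; exact: split0l S.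
case: N => [|N]; first by rewrite big_ord0 subr0.
by case: (step N (AD N)).
Qed.

(** A triangular sum, cut along rows instead of antidiagonals, so that partial
    sums of b appear as factors. *)
Lemma conv_partial_sums a b N :
  \sum_(n < N) \sum_(k < n.+1) a k * b (n - k)%N =
  \sum_(0 <= k < N) a k * \sum_(0 <= l < N - k) b l.
Proof.
elim: N => [|N IHN]; first by rewrite big_ord0 big_geq.
rewrite big_ord_recr IHN [in RHS]big_nat_recr//= subSnn big_nat1.
rewrite [in LHS]big_ord_recr /= subnn addrA; congr (_ + _).
rewrite big_mkord -big_split [in RHS]big_mkord; apply: eq_bigr => k _ /=.
by rewrite subSn 1?ltnW// big_nat_recr//= mulrDr.
Qed.

(** The walk kept in cA, with exits b, and the walk kept in cB, with exits a. *)
Section factorisation.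
Variables (pos cA cB : K -> Prop) (F : K) (g b g' a : nat -> K).
Hypotheses (S : splitting pos cA cB)
  (Eg : exits cA cB F g b) (Eg' : exits cB cA F g' a).

(** In generating functions, g (1 - F) = 1 - b and g' (1 - F) = 1 - a, so that
    g (1 - a) = g g' (1 - F) = g' (1 - b).  The coefficients of positive index
    lie in cA on the left and in cB on the right, hence vanish.  This gives
    g (1 - a) = 1 without any reversal of paths; the proof computes the same
    coefficient of g g' F in two ways. *)
Lemma exits_renewal n : g n.+1 = \sum_(k < n.+1) a k * g (n - k)%N.
Proof.
have [g0 gS Ag Bb] := Eg; have [g'0 g'S Bg' Aa] := Eg'.
pose c n := \sum_(j < n.+1) g j * g' (n - j)%N.
have c1 : c n * F = c n.+1 - g n.+1 + \sum_(k < n.+1) a k * g (n - k)%N.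
  rewrite [in RHS]/c big_ord_recr /= subnn g'0 mulr1 addrK.
  rewrite [X in _ = _ + X](reindex_inj rev_ord_inj) /= -big_split mulr_suml /=.
  apply: eq_bigr => j _; have jn : (j <= n)%N by rewrite -ltnS.
  by rewrite subSS subKn // subSn // -mulrA g'S mulrDr [a _ * _]mulrC.
have c2 : c n * F = c n.+1 - g' n.+1 + \sum_(k < n.+1) b k * g' (n - k)%N.
  rewrite [in RHS]/c big_ord_recl /= g0 mul1r subn0 [g' _ + _]addrC addrK.
  rewrite -big_split mulr_suml /=.
  by apply: eq_bigr => j _; rewrite /bump /= subSS mulrAC gS mulrDl.
have e : g n.+1 + \sum_(k < n.+1) b k * g' (n - k)%N =
    \sum_(k < n.+1) a k * g (n - k)%N + g' n.+1.
  by rewrite -[LHS](addrK (c n * F)) {1}c1 c2; ring.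
apply: (split_uniq S) e => //.
- apply: (split_sum _ S) => k _; case: (n - k)%N => [|m]; first by rewrite g0 mulr1.
  exact: (splitMl S).
- apply: (split_sum _ (splittingC S)) => k _.
  by case: (n - k)%N => [|m]; [rewrite g'0 mulr1|exact: (splitMr S)].
Qed.

Lemma exits_first : a 0%N + b 0%N = F.
Proof.
have [g0 gS _ _] := Eg.
have := exits_renewal 0; rewrite big_ord_recl big_ord0 addr0 subnn g0 mulr1 => <-.
by rewrite -gS g0 mul1r.
Qed.

(** Multiplying g (1 - F) = 1 - b by 1 - a turns the renewal equation into
    1 - F = (1 - a) (1 - b), read here coefficient by coefficient. *)
Lemma exits_convolution n : a n.+1 + b n.+1 = \sum_(k < n.+1) a k * b (n - k)%N.
Proof.
have [g0 gS _ _] := Eg.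
have : \sum_(k < n.+1) a k * g (n - k)%N * F = g n.+2 + b n.+1.
  by rewrite -mulr_suml -exits_renewal gS.
rewrite exits_renewal [in RHS]big_ord_recr /= subnn g0 mulr1.
have -> : \sum_(k < n.+1) a k * g (n - k)%N * F =
    \sum_(k < n.+1) a k * g (n.+1 - k)%N + \sum_(k < n.+1) a k * b (n - k)%N.
  rewrite -big_split; apply: eq_bigr => k _ /=.
  by rewrite -mulrA gS mulrDr subSn // -ltnS.
by rewrite -!addrA => /addrI.
Qed.

Lemma exits_partial_sums N :
  \sum_(k < N.+1) a k + \sum_(k < N.+1) b k =
  F + \sum_(n < N) \sum_(k < n.+1) a k * b (n - k)%N.
Proof.
rewrite -big_split big_ord_recl /= exits_first; congr (_ + _).
by apply: eq_bigr => n _; rewrite exits_convolution.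
Qed.

End factorisation.
End splitting.

(** * Trigonometric polynomials that converge to the indicator of a ray *)

Section ray_approximation.
Variable R : realType.
Implicit Types (x a u w t : R) (k m n : nat).

Lemma bernoulli_ge m w : 0 <= w -> 1 + m%:R * w <= (1 + w) ^+ m.
Proof.
move=> w0; elim: m => [|m IHm]; first by rewrite expr0 mul0r addr0.
rewrite exprS; apply: (@le_trans _ _ ((1 + w) * (1 + m%:R * w))).
  have := mulr_ge0 (ler0n R m) (mulr_ge0 w0 w0); rewrite -natr1; nra.
by rewrite ler_wpM2l // addr_ge0.
Qed.

Lemma bernoulli_le m w : 0 <= w <= 1 -> (1 - w) ^+ m * (1 + m%:R * w) <= 1.
Proof.
move=> /andP[w0 w1].
apply: (@le_trans _ _ ((1 - w) ^+ m * (1 + w) ^+ m)).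
  by rewrite ler_wpM2l ?bernoulli_ge// exprn_ge0// subr_ge0.
rewrite -exprMn exprn_ile1//; first by nra.
nra.
Qed.

Lemma bernoulli_sub_le m w : 0 <= w <= 1 -> 1 - m%:R * w <= (1 - w) ^+ m.
Proof.
move=> /andP[w0 w1]; elim: m => [|m IHm]; first by rewrite expr0 mul0r subr0.
rewrite exprS; apply: (@le_trans _ _ ((1 - w) * (1 - m%:R * w))).
  have := mulr_ge0 (ler0n R m) (mulr_ge0 w0 w0); rewrite -natr1; nra.
by rewrite ler_wpM2l // subr_ge0.
Qed.

(** As k grows this polynomial in t tends to 1 for t > 0 and to 0 for t < 0 on
    [-1, 1]: the base ((1 - t) / 2) ^ k is compared with 2 ^ - k, where the
    Bernoulli inequalities are sharp enough on both sides. *)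
Definition threshold k t := (1 - ((1 - t) / 2) ^+ k) ^+ (2 ^ k).

Lemma threshold_ge0 k t : `|t| <= 1 -> 0 <= threshold k t.
Proof.
rewrite ler_norml => /andP[t1 t2]; rewrite exprn_ge0// subr_ge0 exprn_ile1//; lra.
Qed.

Lemma threshold_le1 k t : `|t| <= 1 -> threshold k t <= 1.
Proof.
rewrite ler_norml => /andP[t1 t2]; rewrite exprn_ile1//.
  by rewrite subr_ge0 exprn_ile1//; lra.
by rewrite lerBlDr lerDl exprn_ge0//; lra.
Qed.

Let threshold_powE k t : (2 ^ k)%:R * ((1 - t) / 2) ^+ k = (1 - t) ^+ k.
Proof. by rewrite natrX -exprMn; congr (_ ^+ _); field. Qed.

Lemma threshold_pos k t w : 0 < w <= t -> t <= 1 ->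
  1 - (1 + k%:R * w)^-1 <= threshold k t.
Proof.
move=> /andP[w0 wt] t1; have w1 : w <= 1 by exact: le_trans t1.
have kw : 0 < 1 + k%:R * w by rewrite ltr_pwDl// mulr_ge0// ltW.
apply: (@le_trans _ _ (1 - (1 - t) ^+ k)).
  rewrite lerD2l lerN2; apply: (@le_trans _ _ ((1 - w) ^+ k)).
    by rewrite lerXn2r ?nnegrE ?subr_ge0// lerD2l lerN2.
  by rewrite -[leRHS]mul1r ler_pdivlMr// bernoulli_le// (ltW w0).
rewrite -threshold_powE bernoulli_sub_le//; apply/andP; split.
  by rewrite exprn_ge0//; lra.
by rewrite exprn_ile1//; lra.
Qed.

Lemma threshold_neg k t w : 0 < w -> t <= - w -> -1 <= t ->
  threshold k t <= (1 + k%:R * w)^-1.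
Proof.
move=> w0 tw t1.
have kw : 0 < 1 + k%:R * w by rewrite ltr_pwDl// mulr_ge0// ltW.
have s01 : 0 <= ((1 - t) / 2) ^+ k <= 1.
  by rewrite exprn_ge0 ?exprn_ile1//; lra.
rewrite -[leRHS]mul1r ler_pdivlMr//; apply: le_trans (bernoulli_le (2 ^ k) s01).
rewrite ler_wpM2l//; first by rewrite exprn_ge0// subr_ge0; case/andP: s01.
rewrite threshold_powE; apply: (@le_trans _ _ ((1 + w) ^+ k)).
  by rewrite bernoulli_ge// ltW.
apply: (@le_trans _ _ ((1 - t) ^+ k)); first by rewrite lerXn2r ?nnegrE; lra.
by rewrite lerDr.
Qed.

Lemma sin_ge_linear u : 0 <= u <= 1 -> cos 1 * u <= sin u.
Proof.
move=> /andP[u0 u1].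
have csin : {within `[0, u], continuous (@sin R)}.
  by apply: continuous_subspaceT; exact: continuous_sin.
have [c + e] := MVT_segment u0 (fun x _ => is_derive_sin x) csin.
rewrite in_itv /= => /andP[c0 cu]; move: e; rewrite sin0 !subr0 => ->.
have c1 := le_trans cu u1; have pi1 : 1 <= pi :> R by have := pi_ge2 R; lra.
rewrite ler_wpM2r// -subr_ge0; have [->|c1'] := eqVneq c 1; first by rewrite subrr.
by rewrite subr_ge0 ltW// ltr_cos ?in_itv/= ?ler01 ?c0 ?(le_trans c1)// lt_neqAle c1'.
Qed.

(** The period of the sine grows with n, so that every x ends up in the monotone
    branch around a.  The extra shift by 1 / n.+1 sends x = a to the negative
    side, and the exponent n.+1 ^ 3 beats the gap 1 / n.+1 ^ 2 seen there. *)
Definition ray_approx a n x :=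
  threshold (n.+1 ^ 3) (sin ((x - a - n.+1%:R^-1) / n.+1%:R)).

Lemma ray_approx01 a n x : 0 <= ray_approx a n x <= 1.
Proof. by rewrite threshold_ge0 ?threshold_le1// sin_max. Qed.

Lemma ray_approx_cvg a x : ray_approx a n x @[n --> \oo] --> (\1_(`]a, +oo[) x : R).
Proof.
have k0 : 0 < cos 1 :> R := cos1_gt0 R.
have cubeE n : (n.+1 ^ 3)%:R = n.+1%:R ^+ 3 :> R by rewrite natrX.
have Nn0 n : 0 < n.+1%:R :> R by [].
have inv_cvg c : 0 < c -> (1 + n.+1%:R * c)^-1 @[n --> \oo] --> (0 : R).
  move=> c0; apply: (@squeeze_cvgr _ _ _ _ (cst 0) (fun n => c^-1 * harmonic n)).
  - near=> n; have N0 := Nn0 n; have cN : 0 < n.+1%:R * c by rewrite mulr_gt0.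
    rewrite invr_ge0 addr_ge0 ?ltW//= /harmonic /= -invfM [c * _]mulrC.
    by rewrite ltf_pV2 ?posrE ?addr_gt0 ?mulr_gt0// ltrDr.
  - exact: cvg_cst.
  - by rewrite -[X in _ --> X](mulr0 c^-1); apply: cvgMr; exact: cvg_harmonic.
rewrite indicE; have [ax|xa] := ltP a x.
  rewrite mem_set /= ?in_itv /= ?ax//.
  (* cos 1 bounds the slope of the sine on [0, 1] from below; x - a loses at most half of
     its size to the shift once n is large. *)
  pose c := cos 1 * (x - a) / 2; have c0 : 0 < c by rewrite divr_gt0 ?mulr_gt0 ?subr_gt0.
  apply: (@squeeze_cvgr _ _ _ _ (fun n => 1 - (1 + n.+1%:R * c)^-1) (cst 1)).
  - near=> n; have /andP[_ ->] := ray_approx01 a n x; rewrite andbT.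
    pose v : R := n.+1%:R^-1; have v0 : 0 < v by rewrite invr_gt0.
    have Nv : n.+1%:R * v = 1 by rewrite mulfV ?gt_eqF.
    have NS : n%:R < n.+1%:R :> R by rewrite ltr_nat.
    have v1 : v * (x - a) <= 1.
      rewrite -Nv mulrC ler_pM2r// (le_trans _ (ltW NS))//.
      by near: n; exact: nbhs_infty_ger.
    have v2 : v <= (x - a) / 2.
      rewrite ler_pdivlMr// -(ler_pM2l (Nn0 n)) mulrA Nv mul1r -ler_pdivrMr ?subr_gt0//.
      by rewrite (le_trans _ (ltW NS))//; near: n; exact: nbhs_infty_ger.
    rewrite /ray_approx -/v; set u := (_ * v); have u01 : 0 <= u <= 1 by rewrite /u; nra.
    have uc : c * v <= sin u.
      by apply: le_trans (sin_ge_linear u01); rewrite /c /u -!mulrA ler_pM2l//; nra.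
    clearbody c.
    apply: le_trans (threshold_pos (w := c * v) _ _ _); last exact: sin_le1; last first.
      by rewrite mulr_gt0.
    rewrite /= lerD2l lerN2 lef_pV2 ?posrE ?addr_gt0 ?mulr_gt0 ?ltr0n ?expn_gt0// lerD2l cubeE.
    have -> : n.+1%:R ^+ 3 * (c * v) = n.+1%:R * c * (n.+1%:R * (n.+1%:R * v)) by ring.
    by rewrite Nv mulr1 ler_peMr ?ler1n ?mulr_ge0// ltW.
  - rewrite -[X in _ --> X]subr0; apply: cvgB; first exact: cvg_cst.
    exact: inv_cvg.
  - exact: cvg_cst.
rewrite memNset /= ?in_itv /= ?andbT ?ltNge ?xa//.
apply: (@squeeze_cvgr _ _ _ _ (cst 0) (fun n => (1 + n.+1%:R * cos 1)^-1)).
- near=> n; have /andP[-> _] := ray_approx01 a n x.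
  pose v : R := n.+1%:R^-1; have v0 : 0 < v by rewrite invr_gt0.
  have Nv : n.+1%:R * v = 1 by rewrite mulfV ?gt_eqF.
  have v1 : v * (v + (a - x)) <= 1.
    rewrite -Nv mulrC ler_pM2r// (@le_trans _ _ (1 + (a - x)))//.
      by rewrite lerD2r invf_le1// ler1n.
    by rewrite -nat1r lerD2l; near: n; exact: nbhs_infty_ger.
  rewrite /= /ray_approx -/v; set u := (_ * v); have u01 : 0 <= - u <= 1 by rewrite /u; nra.
  have uc : sin u <= - (cos 1 * v ^+ 2).
    rewrite lerNr -sinN; apply: le_trans (sin_ge_linear u01).
    by rewrite ler_pM2l// /u; nra.
  apply: le_trans (threshold_neg (w := cos 1 * v ^+ 2) _ _ uc _) _; last first.
    rewrite lef_pV2 ?posrE ?addr_gt0 ?mulr_gt0 ?ltr0n ?expn_gt0 ?exprn_gt0// lerD2l cubeE.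
    have -> : n.+1%:R ^+ 3 * (cos 1 * v ^+ 2) = n.+1%:R * cos 1 * (n.+1%:R * v) ^+ 2 by ring.
    by rewrite Nv expr1n mulr1.
  - exact: sin_geN1.
  - by rewrite mulr_gt0 ?exprn_gt0.
- exact: cvg_cst.
- exact: inv_cvg.
Unshelve. all: by end_near. Qed.
End ray_approximation.

(** * Uniqueness of Fourier transforms of finite measures *)

Section fourier.
Variable R : realType.
Implicit Types (f g : R -> R) (x a z : R).

(** The characteristic function of X under m on the event E. *)
Definition cft d (T : measurableType d) (m : {measure set T -> \bar R})
    (E : set T) (X : T -> R) (z : R) : R[i] :=
  ((\int[m]_(w in E) cos (z * X w)) +i* (\int[m]_(w in E) sin (z * X w)))%C.

(** The span of the functions whose integrals are read off the transform; it is
    closed under products by [trigM]. *)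
Inductive trigonometric : (R -> R) -> Prop :=
| trig_cos z : trigonometric (fun x => cos (z * x))
| trig_sin z : trigonometric (fun x => sin (z * x))
| trigD f g : trigonometric f -> trigonometric g ->
    trigonometric (fun x => f x + g x)
| trigZ c f : trigonometric f -> trigonometric (fun x => c * f x).

Lemma trigM f g : trigonometric f -> trigonometric g ->
  trigonometric (fun x => f x * g x).
Proof.
move=> tf tg; elim: tf => [z|z|f1 f2 _ tf1 _ tf2|c f1 _ tf1].
- elim: tg => [y|y|g1 g2 _ tg1 _ tg2|c g1 _ tg1].
  + have := trigD (trigZ 2^-1 (trig_cos (z - y))) (trigZ 2^-1 (trig_cos (z + y))).
    congr trigonometric; apply/funext => x.
    by rewrite mulrBl mulrDl cosB cosD; field.
  + have := trigD (trigZ 2^-1 (trig_sin (z + y))) (trigZ (- 2^-1) (trig_sin (z - y))).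
    congr trigonometric; apply/funext => x.
    by rewrite mulrBl mulrDl sinB sinD; field.
  + by have := trigD tg1 tg2; congr trigonometric; apply/funext => x; rewrite mulrDr.
  + by have := trigZ c tg1; congr trigonometric; apply/funext => x; rewrite mulrCA.
- elim: tg => [y|y|g1 g2 _ tg1 _ tg2|c g1 _ tg1].
  + have := trigD (trigZ 2^-1 (trig_sin (z + y))) (trigZ 2^-1 (trig_sin (z - y))).
    congr trigonometric; apply/funext => x.
    by rewrite mulrBl mulrDl sinB sinD; field.
  + have := trigD (trigZ 2^-1 (trig_cos (z - y))) (trigZ (- 2^-1) (trig_cos (z + y))).
    congr trigonometric; apply/funext => x.
    by rewrite mulrBl mulrDl cosB cosD; field.
  + by have := trigD tg1 tg2; congr trigonometric; apply/funext => x; rewrite mulrDr.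
  + by have := trigZ c tg1; congr trigonometric; apply/funext => x; rewrite mulrCA.
- by have := trigD tf1 tf2; congr trigonometric; apply/funext => x; rewrite mulrDl.
- by have := trigZ c tf1; congr trigonometric; apply/funext => x; rewrite mulrA.
Qed.

Lemma trig_cst c : trigonometric (fun=> c).
Proof.
have := trigZ c (trig_cos 0); congr trigonometric; apply/funext => x.
by rewrite mul0r cos0 mulr1.
Qed.

Lemma trigX f k : trigonometric f -> trigonometric (fun x => f x ^+ k).
Proof.
move=> tf; elim: k => [|k IHk]; first exact: trig_cst.
by have := trigM tf IHk; congr trigonometric; apply/funext => x; rewrite exprS.
Qed.

Lemma trig_threshold k f : trigonometric f ->
  trigonometric (fun x => threshold k (f x)).
Proof.
move=> tf; apply: trigX.
have t1 := trigZ (- 1) (trigX k (trigD (trig_cst 2^-1) (trigZ (- 2^-1) tf))).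
have := trigD (trig_cst 1) t1; congr trigonometric; apply/funext => x.
by rewrite mulN1r; congr (1 - _ ^+ _); field.
Qed.

Lemma trig_ray_approx a n : trigonometric (ray_approx a n).
Proof.
apply: trig_threshold; set v := n.+1%:R^-1; pose s := (a + v) * v.
have := trigD (trigZ (cos s) (trig_sin v)) (trigZ (- sin s) (trig_cos v)).
congr trigonometric; apply/funext => x.
have -> : (x - a - v) * v = v * x - s by rewrite /s; ring.
by rewrite sinB; ring.
Qed.

Lemma trig_measurable f : trigonometric f -> measurable_fun setT f.
Proof.
elim=> [z|z|f1 f2 _ m1 _ m2|c f1 _ m1].
- apply: continuous_measurable_fun => x; apply: continuous_comp; last exact: continuous_cos.
  exact: mulrl_continuous.
- apply: continuous_measurable_fun => x; apply: continuous_comp; last exact: continuous_sin.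
  exact: mulrl_continuous.
- exact: measurable_funD.
- exact: measurable_funM.
Qed.

Lemma trig_bounded f : trigonometric f -> exists M, forall x, `|f x| <= M.
Proof.
elim=> [z|z|f1 f2 _ [M1 b1] _ [M2 b2]|c f1 _ [M1 b1]].
- by exists 1 => x; exact: cos_max.
- by exists 1 => x; exact: sin_max.
- by exists (M1 + M2) => x; rewrite (le_trans (ler_normD _ _))// lerD.
- by exists (`|c| * M1) => x; rewrite normrM ler_wpM2l.
Qed.

Lemma bounded_integrable d (T : measurableType d) (m : {finite_measure set T -> \bar R})
    (E : set T) (h : T -> R) M : measurable E -> measurable_fun E h ->
  (forall w, `|h w| <= M) -> m.-integrable E (EFin \o h).
Proof.
move=> mE mh hM; apply: measurable_bounded_integrable => //.
  by rewrite ltey_eq fin_num_measure.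
exists M; split; first exact: num_real.
by move=> y My w /= _; exact: le_trans (hM w) (ltW My).
Qed.

Lemma trig_integrable (m : {finite_measure set R -> \bar R}) f :
  trigonometric f -> m.-integrable setT (EFin \o f).
Proof.
move=> tf; have [M hM] := trig_bounded tf.
by apply: bounded_integrable hM => //; exact: trig_measurable.
Qed.

Lemma trig_Rintegral_eq (m1 m2 : {finite_measure set R -> \bar R}) :
  cft m1 setT id = cft m2 setT id ->
  forall f, trigonometric f -> \int[m1]_x f x = \int[m2]_x f x.
Proof.
move=> e12 f; elim=> [z|z|f1 f2 t1 e1 t2 e2|c f1 t1 e1].
- by have := congr1 (@^~ z) e12 => -[].
- by have := congr1 (@^~ z) e12 => -[].
- by rewrite !RintegralD//; try exact: trig_integrable; rewrite e1 e2.
- by rewrite !RintegralZl//; try exact: trig_integrable; rewrite e1.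
Qed.

(** The integrals of [ray_approx a n] are determined by the transform and converge
    to the measure of ]a, +oo[ by dominated convergence; rays form a pi-system. *)
Lemma cft_inj (m1 m2 : {finite_measure set R -> \bar R}) :
  cft m1 setT id = cft m2 setT id ->
  forall B, measurable B -> m1 B = m2 B.
Proof.
move=> e12; pose I (m : {finite_measure set R -> \bar R}) a n : \bar R :=
  (\int[m]_x (ray_approx a n x)%:E)%E.
have Icvg m a : I m a n @[n --> \oo] --> m `]a, +oo[%classic.
  have : (\int[m]_x (\1_(`]a, +oo[) x : R)%:E)%E = m `]a, +oo[%classic.
    by rewrite integral_indic// setIT.
  move=> <-; apply: (@dominated_cvg _ _ _ m setT _ _ _ (cst 1%:E)) => //.
  - by move=> n; apply/measurable_EFinP; apply: trig_measurable; exact: trig_ray_approx.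
  - by move=> x _; apply: cvg_EFin; [exact: nearW|exact: ray_approx_cvg].
  - by apply: (@bounded_integrable _ _ m setT (cst 1) 1) => // ?; rewrite normr1.
  - move=> n x _; rewrite abse_EFin lee_fin; have /andP[? ?] := ray_approx01 a n x.
    by rewrite ger0_norm.
have I12 a n : I m1 a n = I m2 a n.
  have fin m := integrable_fin_num measurableT (trig_integrable m (trig_ray_approx a n)).
  rewrite /I -(fineK (fin m1)) -(fineK (fin m2)); congr EFin.
  by apply: trig_Rintegral_eq => //; exact: trig_ray_approx.
have ray a : m1 `]a, +oo[%classic = m2 `]a, +oo[%classic.
  have I12a : I m1 a = I m2 a by apply/funext => n; exact: I12.
  by apply: (cvg_unique _ (Icvg m1 a)) => //; rewrite I12a; exact: Icvg.
apply: (measure_unique (@RGenOInfty.G R) (fun n => `]- n%:R, +oo[%classic)).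
- exact: RGenOInfty.measurableE.
- move=> _ _ [a ->] [b ->]; exists (Num.max a b).
  by apply/seteqP; split=> x; rewrite /= !in_itv/= !andbT gt_max => /andP.
- by move=> n; exists (- n%:R).
- apply/seteqP; split=> // x _; have [n _ xn] := nbhs_infty_gtr `|x|.
  exists n => //=; rewrite in_itv/= andbT.
  by have := xn n (leqnn n); rewrite ltr_norml => /andP[].
- by move=> A [a ->]; exact: ray.
- by move=> n; rewrite ltey_eq fin_num_measure.
Qed.

End fourier.
Arguments bounded_integrable {R d T m E h} M.

(** * Image measures, sums, products and their transforms *)

Section image_measure.
Context d d' (T : measurableType d) (T' : measurableType d') (R : realType).
Variables (m : {finite_measure set T -> \bar R}) (E : set T) (mE : measurable E).
Variable phi : {mfun T >-> T'}.

(** The law of phi on the event E. *)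
Definition image_measure : set T' -> \bar R := pushforward (mrestr m mE) phi.

Let image0 : image_measure set0 = 0%E. Proof. exact: measure0. Qed.

Let image_ge0 B : (0 <= image_measure B)%E. Proof. exact: measure_ge0. Qed.

Let image_sigma_additive : semi_sigma_additive image_measure.
Proof. exact: measure_semi_sigma_additive. Qed.

HB.instance Definition _ := isMeasure.Build _ _ _ image_measure
  image0 image_ge0 image_sigma_additive.

Let image_fin : fin_num_fun image_measure.
Proof.
move=> B mB; rewrite /image_measure /pushforward; apply: fin_num_measure.
by rewrite -[X in measurable X]setTI; exact: measurable_funPT.
Qed.

HB.instance Definition _ := Measure_isFinite.Build _ _ _ image_measure image_fin.

Lemma image_measureE B : image_measure B = m (E `&` phi @^-1` B).
Proof. by rewrite /image_measure /pushforward /mrestr setIC. Qed.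

End image_measure.

Section finite_measure_ops.
Context d d' (T : measurableType d) (T' : measurableType d') (R : realType).
Variables (m1 m2 : {finite_measure set T -> \bar R}).
Variable (m3 : {finite_measure set T' -> \bar R}).

Definition measure_sum : set T -> \bar R :=
  msum (fun n => if n is 0%N then m1 else m2) 2.

HB.instance Definition _ := Measure.on measure_sum.

Lemma measure_sumE B : measure_sum B = (m1 B + m2 B)%E.
Proof. exact: measure_addE. Qed.

Let sum_fin : fin_num_fun measure_sum.
Proof. by move=> B mB; rewrite measure_sumE fin_numD !fin_num_measure. Qed.

HB.instance Definition _ := Measure_isFinite.Build _ _ _ measure_sum sum_fin.

Definition measure_prod : set (T * T') -> \bar R := (m1 \x m3)%E.

HB.instance Definition _ := Measure.on measure_prod.

Let prod_fin : fin_num_fun measure_prod.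
Proof.
have prodT : measure_prod setT = (m1 setT * m3 setT)%E.
  by rewrite -setXTT [LHS]product_measure1E.
apply: lty_fin_num_fun; rewrite /= prodT.
by rewrite ltey_eq fin_numM// fin_num_measure.
Qed.

HB.instance Definition _ := Measure_isFinite.Build _ _ _ measure_prod prod_fin.

End finite_measure_ops.

Section transforms.
Context d (T : measurableType d) (R : realType).
Implicit Types (m : {finite_measure set T -> \bar R}) (E : set T) (X : T -> R).

Lemma cos_integrable m E X z : measurable E -> measurable_fun E X ->
  m.-integrable E (EFin \o (fun w => cos (z * X w))).
Proof.
move=> mE mX; apply: (bounded_integrable 1) => // [|w]; last exact: cos_max.
exact: (measurableT_comp (trig_measurable (trig_cos z)) mX).
Qed.

Lemma sin_integrable m E X z : measurable E -> measurable_fun E X ->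
  m.-integrable E (EFin \o (fun w => sin (z * X w))).
Proof.
move=> mE mX; apply: (bounded_integrable 1) => // [|w]; last exact: sin_max.
exact: (measurableT_comp (trig_measurable (trig_sin z)) mX).
Qed.

Lemma cft_setU m E1 E2 X z : measurable E1 -> measurable E2 ->
  measurable_fun setT X -> E1 `&` E2 = set0 ->
  cft m (E1 `|` E2) X z = cft m E1 X z + cft m E2 X z.
Proof.
move=> mE1 mE2 mX E12; have d12 : [disjoint E1 & E2] by rewrite disj_set2E E12.
have mU := measurableU _ _ mE1 mE2.
by rewrite /cft !Rintegral_setU//; [exact: sin_integrable (measurable_funTS mX)|
  exact: cos_integrable (measurable_funTS mX)].
Qed.

Lemma eq_cft_measure m1 m2 X :
  (forall B, measurable B -> m1 B = m2 B) -> cft m1 setT X = cft m2 setT X.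
Proof.
move=> e; apply/funext => z; rewrite /cft /Rintegral.
by congr (fine _ +i* fine _)%C; apply: eq_measure_integral => B mB _; exact: e.
Qed.

Lemma cft_measure_add m1 m2 X z : measurable_fun setT X ->
  cft (measure_sum m1 m2) setT X z = cft m1 setT X z + cft m2 setT X z.
Proof.
move=> mX; have add (h : T -> R) : (forall m, m.-integrable setT (EFin \o h)) ->
    \int[measure_sum m1 m2]_x h x = \int[m1]_x h x + \int[m2]_x h x.
  move=> ih; have fi m := integrable_fin_num measurableT (ih m).
  rewrite /Rintegral -(fineD (fi m1) (fi m2)); congr fine.
  rewrite -(integral_measure_add measurableT (ih m1) (ih m2)).
  exact: eq_measure_integral.
rewrite /cft !add// => m; [exact: sin_integrable|exact: cos_integrable].
Qed.

Lemma cft0 m E X : measurable E ->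
  cft m E X 0 = (fine (m E))%:C%C.
Proof.
move=> mE; rewrite /cft.
under eq_Rintegral do rewrite mul0r cos0.
under [X in (_ +i* X)%C]eq_Rintegral do rewrite mul0r sin0.
by rewrite !Rintegral_cst// mul1r mul0r.
Qed.

Lemma cft_bound m E X z : measurable E -> measurable_fun E X ->
  `|complex.Re (cft m E X z)| <= fine (m E) /\
  `|complex.Im (cft m E X z)| <= fine (m E).
Proof.
move=> mE mX.
have bnd (h : T -> R) : m.-integrable E (EFin \o h) -> (forall w, `|h w| <= 1) ->
    `|\int[m]_(w in E) h w| <= fine (m E).
  move=> ih h1; apply: le_trans (le_normr_Rintegral mE ih) _.
  rewrite -[leRHS]mul1r -Rintegral_cst//; apply: le_Rintegral => //.
  - exact: integrable_norm.
  - by apply: (bounded_integrable 1) => // ?; rewrite normr1.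
split; apply: bnd.
- exact: cos_integrable.
- by move=> w; exact: cos_max.
- exact: sin_integrable.
- by move=> w; exact: sin_max.
Qed.

End transforms.

Lemma cft_image d d' (T : measurableType d) (T' : measurableType d') (R : realType)
    (m : {finite_measure set T -> \bar R}) (E : set T) (mE : measurable E)
    (phi : {mfun T >-> T'}) (Y : T' -> R) : measurable_fun setT Y ->
  cft (image_measure m mE phi) setT Y = cft m E (Y \o phi).
Proof.
move=> mY; apply/funext => z.
have mYphi : measurable_fun setT (Y \o phi) by exact: measurableT_comp.
have tr (h : R -> R) : (forall x, `|h x| <= 1) -> measurable_fun setT h ->
    \int[image_measure m mE phi]_w h (Y w) = \int[m]_(w in E) h (Y (phi w)).
  move=> h1 mh; rewrite /Rintegral; congr fine.
  have mhY := measurableT_comp mh mY; have mhYp := measurableT_comp mh mYphi.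
  have ir : (mrestr m mE).-integrable setT (EFin \o (h \o (Y \o phi))).
    by apply: (bounded_integrable 1) => // w; exact: h1.
  rewrite integral_pushforward//; last exact/measurable_EFinP.
  rewrite preimage_setT (negligible_integral (measurableC mE))//; last first.
    by rewrite /= /mrestr setICl measure0.
  rewrite setTD setCK; apply: eq_measure_integral => B mB BE.
  by rewrite /= /mrestr setIidl.
rewrite /cft (tr (fun x => cos (z * x))); last 2 first.
- by move=> x; exact: cos_max.
- by have := trig_measurable (trig_cos z).
rewrite (tr (fun x => sin (z * x)))// => [x|]; first exact: sin_max.
by have := trig_measurable (trig_sin z).
Qed.

(** * Transforms carried by a set *)

Section independent_sum.
Variable R : realType.

Lemma Rintegral_prod d1 d2 (T1 : measurableType d1) (T2 : measurableType d2)
    (m1 : {finite_measure set T1 -> \bar R}) (m2 : {finite_measure set T2 -> \bar R})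
    (u : T1 -> R) (v : T2 -> R) :
  measurable_fun setT u -> measurable_fun setT v ->
  (forall x, `|u x| <= 1) -> (forall y, `|v y| <= 1) ->
  \int[measure_prod m1 m2]_p (u p.1 * v p.2) = (\int[m1]_x u x) * (\int[m2]_y v y).
Proof.
move=> mu mv u1 v1.
have iu : m1.-integrable setT (EFin \o u) by exact: (bounded_integrable 1).
have iv : m2.-integrable setT (EFin \o v) by exact: (bounded_integrable 1).
pose f (p : T1 * T2) := (u p.1 * v p.2)%:E.
have muv : measurable_fun setT (fun p : T1 * T2 => u p.1 * v p.2).
  by apply: measurable_funM; exact: measurableT_comp.
have iuv : (measure_prod m1 m2).-integrable setT f.
  by apply: (bounded_integrable 1) => // p; rewrite normrM mulr_ile1.
have := integral12_prod_meas1 iuv; rewrite /Rintegral => <-.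
rewrite -RintegralZr//; congr fine; apply: eq_integral => x _.
rewrite /fubini_F /f /=; under eq_integral do rewrite EFinM.
by rewrite integralZl// EFinM fineK// integrable_fin_num.
Qed.

Lemma cft_prod d1 d2 (T1 : measurableType d1) (T2 : measurableType d2)
    (m1 : {finite_measure set T1 -> \bar R}) (m2 : {finite_measure set T2 -> \bar R})
    (X : T1 -> R) (Y : T2 -> R) z :
  measurable_fun setT X -> measurable_fun setT Y ->
  cft (measure_prod m1 m2) setT (fun p => X p.1 + Y p.2) z =
  cft m1 setT X z * cft m2 setT Y z.
Proof.
move=> mX mY; rewrite /cft.
pose wave (f : R -> R) := (f = cos \/ f = sin).
have [wc ws] : wave cos /\ wave sin by split; [left|right].
have wave_le1 f t : wave f -> `|f t| <= 1 by case=> ->; [exact: cos_max|exact: sin_max].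
have wave_meas f d (T : measurableType d) (U : T -> R) : wave f -> measurable_fun setT U ->
    measurable_fun setT (fun w => f (z * U w)).
  move=> wf mU; apply: (@measurableT_comp _ _ _ _ _ _ (fun x => f (z * x))) => //.
  case: wf => ->; first by have := trig_measurable (trig_cos z).
  by have := trig_measurable (trig_sin z).
have iprod f g : wave f -> wave g -> (measure_prod m1 m2).-integrable setT
    (EFin \o (fun p => f (z * X p.1) * g (z * Y p.2))).
  move=> wf wg; apply: (bounded_integrable 1) => // [|p].
    by apply: measurable_funM; apply: wave_meas => //; exact: measurableT_comp.
  by rewrite normrM mulr_ile1// wave_le1.
have Rprod f g : wave f -> wave g ->
    \int[measure_prod m1 m2]_p (f (z * X p.1) * g (z * Y p.2)) =
    (\int[m1]_x f (z * X x)) * (\int[m2]_y g (z * Y y)).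
  move=> wf wg; have [mf mg] := (wave_meas _ _ _ _ wf mX, wave_meas _ _ _ _ wg mY).
  by rewrite -(Rintegral_prod _ _ mf mg)// => ?; exact: wave_le1.
under eq_Rintegral do rewrite mulrDr cosD.
under [X in (_ +i* X)%C]eq_Rintegral do rewrite mulrDr sinD.
have [icc iss] := (iprod _ _ wc wc, iprod _ _ ws ws).
have [ics isc] := (iprod _ _ wc ws, iprod _ _ ws wc).
rewrite (RintegralB _ icc iss)// (RintegralD _ isc ics)// !Rprod//.
apply/eqP; rewrite eq_complex /=; apply/andP; split; apply/eqP => //.
by rewrite addrC.
Qed.

(** Product of transforms under a one-sided independence: Y has law k and is
    independent of X on the event E, whose mass need not be 1. *)
Lemma cft_independent d (T : measurableType d) (m : {finite_measure set T -> \bar R})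
    (E : set T) (X Y : {mfun T >-> R}) (k : {finite_measure set R -> \bar R}) :
  measurable E ->
  (forall B C, measurable B -> measurable C ->
    m (E `&` (X @^-1` B `&` Y @^-1` C)) = (m (E `&` X @^-1` B) * k C)%E) ->
  cft m E (fun w => X w + Y w) = cft m E X * cft k setT id.
Proof.
move=> mE ind.
have mXY : measurable_fun setT (fun w => (X w, Y w)) by exact: measurable_fun_pair.
pose mXYb := isMeasurableFun.Build _ _ _ _ _ mXY.
pose XY : {mfun T >-> (R * R)%type} := HB.pack (fun w => (X w, Y w)) mXYb.
have madd : measurable_fun setT (fun p : R * R => p.1 + p.2) by exact: measurable_funD.
rewrite (_ : (fun w => X w + Y w) = (fun p : R * R => p.1 + p.2) \o XY)//.
rewrite -cft_image//.
rewrite -(@eq_cft_measure _ _ _ (measure_prod (image_measure m mE X) k)) => [|B mB].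
  apply/funext => z; rewrite (cft_prod _ _ z (@measurable_id _ _ _) (@measurable_id _ _ _)).
  by rewrite -[in RHS](_ : cft (image_measure m mE X) setT id = cft m E X)// cft_image.
apply: product_measure_unique => // A C mA mC.
by rewrite /= !image_measureE ind.
Qed.

End independent_sum.

Section carried.
Variable R : realType.
Implicit Types (A B : set R) (f h : R -> R[i]).

(** Finite measures are handled through their transforms: convolution becomes a
    pointwise product, and the commutative ring of functions replaces signed
    measures. *)
Definition carried A f := exists2 k : {finite_measure set R -> \bar R},
  k (~` A) = 0%E & f = cft k setT id.

Lemma carried_cft d (T : measurableType d) (m : {finite_measure set T -> \bar R})
    (E : set T) (X : T -> R) A : measurable E -> measurable_fun setT X ->
  (forall w, E w -> A (X w)) -> carried A (cft m E X).
Proof.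
move=> mE mX EA; pose mXb := isMeasurableFun.Build _ _ _ _ _ mX.
pose X' : {mfun T >-> R} := HB.pack X mXb.
exists (image_measure m mE X'); last by rewrite cft_image.
rewrite /= image_measureE (_ : _ `&` _ = set0) ?measure0//.
by apply/seteqP; split=> // w [/EA].
Qed.

Lemma carried0 A : carried A 0.
Proof.
have -> : 0 = cft (dirac (0 : R) : {finite_measure set R -> \bar R}) set0 idfun :> (R -> R[i]).
  by apply/funext => z; rewrite /cft !Rintegral_set0.
apply: carried_cft; [exact: measurable0|exact: measurable_id|by move=> w []].
Qed.

Lemma carriedW A f : carried A f -> carried setT f.
Proof. by case=> k _ ->; exists k => //; rewrite setCT measure0. Qed.

Lemma carriedD A f h : carried A f -> carried A h -> carried A (f + h).
Proof.
move=> [k k0 ->] [l l0 ->]; exists (measure_sum k l).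
  by rewrite [LHS]measure_sumE k0 l0 adde0.
by apply/funext => z; rewrite cft_measure_add.
Qed.

Lemma carriedM A f h : measurable A -> (forall x y, A x -> A y -> A (x + y)) ->
  carried A f -> carried A h -> carried A (f * h).
Proof.
move=> mA AD [k k0 ->] [l l0 ->].
have madd : measurable_fun setT (fun p : R * R => p.1 + p.2) by exact: measurable_funD.
pose maddb := isMeasurableFun.Build _ _ _ _ _ madd.
pose add : {mfun (R * R)%type >-> R} := HB.pack (fun p : R * R => p.1 + p.2) maddb.
have mCA := measurableC mA.
have m1 : measurable (~` A `*` [set: R]) by exact: measurableX.
have m2 : measurable ([set: R] `*` ~` A) by exact: measurableX.
exists (image_measure (measure_prod k l) measurableT add).
  apply/eqP; rewrite -measure_le0 [leLHS]image_measureE setTI.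
  apply: (@le_trans _ _ (measure_prod k l ((~` A `*` setT) `|` (setT `*` ~` A)))).
    apply: le_measure; rewrite ?inE//; first 1 last.
    - exact: measurableU.
    - move=> [x y] /= nA; have [Ax|] := pselect (A x); last by left.
      by right; split=> // Ay; apply: nA; exact: AD.
    by rewrite -[X in measurable X]setTI; apply: (measurable_funPT add).
  apply: (le_trans (measureU2 _ m1 m2)).
  apply: (@le_trans _ _ (k (~` A) * l setT + k setT * l (~` A))%E).
    rewrite -(product_measure1E k l mCA measurableT).
    by rewrite -(product_measure1E k l measurableT mCA).
  by rewrite k0 l0 mul0e mule0 adde0.
apply/funext => z; rewrite cft_image//.
by rewrite (cft_prod k l z (@measurable_id _ _ _) (@measurable_id _ _ _)).
Qed.

Lemma carried1 A : measurable A -> A 0 -> carried A 1.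
Proof.
move=> mA A0; exists (dirac (0 : R) : {finite_measure set R -> \bar R}).
  by rewrite [LHS]diracE memNset// => /(_ A0).
apply/funext => z; rewrite /cft /Rintegral !integral_dirac//=; last 2 first.
- by apply/measurable_EFinP; have := trig_measurable (trig_sin z).
- by apply/measurable_EFinP; have := trig_measurable (trig_cos z).
by rewrite indicT !mul1r mulr0 cos0 sin0.
Qed.

Lemma carried_split A f : measurable A -> carried setT f ->
  exists u v, [/\ carried A u, carried (~` A) v & f = u + v].
Proof.
move=> mA [k _ ->]; exists (cft k A idfun), (cft k (~` A) idfun); split.
- by apply: carried_cft => //; exact: measurable_id.
- by apply: carried_cft => //; first [exact: measurableC|exact: measurable_id].
- apply/funext => z; rewrite [RHS](_ : _ = cft k A idfun z + cft k (~` A) idfun z)//.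
  have mCA := measurableC mA.
  by rewrite -(cft_setU _ _ mA mCA (@measurable_id _ _ _) (setICr A)) setUv.
Qed.

(** By [cft_inj] the equality holds between the sums of measures, and restricting
    it to A isolates the first terms. *)
Lemma carried_uniq A u u' v v' : measurable A -> carried A u -> carried A u' ->
  carried (~` A) v -> carried (~` A) v' -> u + v = u' + v' -> u = u'.
Proof.
move=> mA [k k0 ->] [k' k'0 ->] [l + ->] [l' + ->]; rewrite setCK => l0 l'0 e.
have sum_eq : forall B, measurable B -> measure_sum k l B = measure_sum k' l' B.
  by apply: cft_inj; apply/funext => z; rewrite !cft_measure_add//; have := congr1 (@^~ z) e.
have onA (n n' : {finite_measure set R -> \bar R}) B : measurable B ->
    n (~` A) = 0%E -> n' A = 0%E -> measure_sum n n' (B `&` A) = n B.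
  move=> mB n0 n'0; rewrite measure_sumE.
  have [mBA mBC] := (measurableI _ _ mB mA, measurableI _ _ mB (measurableC mA)).
  have -> : n' (B `&` A) = 0%E by apply: subset_measure0 n'0.
  have nBC : n (B `&` ~` A) = 0%E.
    by apply: subset_measure0 n0 => //; exact: measurableC.
  rewrite adde0 -[in RHS](setIT B) -(setUv A) setIUr measureU//; last first.
    by rewrite setIACA setICr setI0.
  by rewrite [X in (_ + X)%E]nBC adde0.
apply: eq_cft_measure => B mB.
by rewrite -(onA k l B)// -(onA k' l' B)// sum_eq//; exact: measurableI.
Qed.

Lemma carried_splitting A : measurable A ->
  (forall x y, A x -> A y -> A (x + y)) ->
  (forall x y, (~` A) x -> (~` A) y -> (~` A) (x + y)) ->
  splitting (carried setT) (carried A) (carried (~` A)).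
Proof.
move=> mA AD CD; have mCA := measurableC mA; split.
- exact: carriedD.
- by move=> f h; apply: carriedM.
- exact: carried0.
- exact: carriedD.
- by move=> f h; apply: carriedM.
- exact: carriedW.
- exact: carried0.
- exact: carriedD.
- by move=> f h; apply: carriedM.
- exact: carriedW.
- by move=> f; exact: carried_split.
- by move=> u u' v v'; exact: carried_uniq.
Qed.

End carried.

(** * Total masses and summation of the convolution identities *)

Section mass.
Variable R : realType.
Implicit Types (f h : R -> R[i]) (A : set R).

Definition mass f : R := complex.Re (f 0).

Lemma massD f h : mass (f + h) = mass f + mass h.
Proof. by rewrite /mass -raddfD. Qed.

Lemma mass_sum (I : Type) (r : seq I) (P : pred I) (f : I -> R -> R[i]) :
  mass (\sum_(i <- r | P i) f i) = \sum_(i <- r | P i) mass (f i).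
Proof. by apply: (big_morph mass massD). Qed.

Lemma carried_massE A f : carried A f -> f 0 = (mass f)%:C%C.
Proof. by case=> k _ ->; rewrite /mass cft0. Qed.

Lemma massM A f h : carried A f -> mass (f * h) = mass f * mass h.
Proof.
move=> cf; rewrite /mass [(f * h) 0](_ : _ = f 0 * h 0)// (carried_massE cf).
by case: (h 0) => x y /=; rewrite mul0r subr0.
Qed.

Lemma carried_mass_ge0 A f : carried A f -> 0 <= mass f.
Proof. by case=> k _ ->; rewrite /mass cft0//= fine_ge0. Qed.

(** Bounds on both coordinates suffice to pass from masses to pointwise limits. *)
Lemma carried_bound A f z : carried A f ->
  `|complex.Re (f z)| <= mass f /\ `|complex.Im (f z)| <= mass f.
Proof.
by case=> k _ ->; rewrite /mass cft0//=; apply: cft_bound => //; exact: measurable_id.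
Qed.

End mass.

Section cauchy_product.
Variable R : realType.
Implicit Types (a b : nat -> R -> R[i]).

(** Mertens-type summation: e is the N-th partial sum of a + b = F + a b.  All
    the errors are transforms of measures, so it is enough to bound their masses,
    which are real numbers. *)
Lemma cauchy_product a b hp hm F :
  (forall n, carried setT (a n)) -> (forall n, carried setT (b n)) ->
  carried setT hp -> carried setT hm ->
  (forall N, carried setT (hp - \sum_(k < N) a k)) ->
  (forall N, carried setT (hm - \sum_(k < N) b k)) ->
  mass (hp - \sum_(k < N) a k) @[N --> \oo] --> 0 ->
  mass (hm - \sum_(k < N) b k) @[N --> \oo] --> 0 ->
  (forall N, \sum_(k < N.+1) a k + \sum_(k < N.+1) b k =
    F + \sum_(n < N) \sum_(k < n.+1) a k * b (n - k)%N) ->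
  F + hp * hm = hp + hm.
Proof.
move=> ca cb chp chm cr cs r0 s0 e.
have cD := @carriedD R setT.
have cM (f h : R -> R[i]) : carried setT f -> carried setT h -> carried setT (f * h).
  exact: carriedM.
have csum (I : Type) (r : seq I) (P : pred I) (f : I -> R -> R[i]) :
    (forall i, P i -> carried setT (f i)) -> carried setT (\sum_(i <- r | P i) f i).
  by move=> cf; apply: big_ind => //; exact: carried0.
pose r N := hp - \sum_(k < N) a k; pose s N := hm - \sum_(k < N) b k.
have {}cr N : carried setT (r N) := cr N.
have {}cs N : carried setT (s N) := cs N.
pose C N := \sum_(n < N) \sum_(k < n.+1) a k * b (n - k)%N.
have sE N : \sum_(0 <= l < N) b l = hm - s N by rewrite big_mkord /s opprB addrC subrK.
have rE N : \sum_(0 <= l < N) a l = hp - r N by rewrite big_mkord /r opprB addrC subrK.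
have ce N : carried setT (hp * hm - C N).
  have -> : hp * hm - C N = \sum_(0 <= k < N) a k * s (N - k)%N + r N * hm.
    rewrite /C conv_partial_sums -[hp](subrK (r N)) -rE mulrDl mulr_suml.
    rewrite addrAC -sumrB; congr (_ + _); apply: eq_bigr => k _.
    by rewrite sE -mulrBr opprB addrC subrK.
  by apply: (cD); [apply: (csum) => k _; exact: cM|exact: cM].
(* The square [0, M[ x [0, M[ is contained in the triangle of size 2 M. *)
have cC M : carried setT (C (M + M)%N - (hp - r M) * (hm - s M)).
  have -> : C (M + M)%N - (hp - r M) * (hm - s M) =
      \sum_(0 <= k < M) a k * \sum_(M <= l < M + M - k) b l
      + \sum_(M <= k < M + M) a k * \sum_(0 <= l < M + M - k) b l.
    rewrite /C conv_partial_sums (@big_cat_nat _ _ _ M)//= ?leq_addr// addrAC; congr (_ + _).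
    rewrite -rE -sE mulr_suml -sumrB; apply: eq_big_nat => k /andP[_ kM].
    have MM : (M <= M + M - k)%N by rewrite -addnBA ?leq_addr// ltnW.
    by rewrite -mulrBr (@big_cat_nat _ _ _ M _ (M + M - k))//= addrAC subrr add0r.
  by apply: (cD); apply: (csum) => k _; apply: (cM) => //; apply: (csum).
have decr (x : nat -> R -> R[i]) (h : R -> R[i]) N M : (forall n, carried setT (x n)) ->
    (N <= M)%N -> mass (h - \sum_(k < M) x k) <= mass (h - \sum_(k < N) x k).
  move=> cx NM; rewrite -subr_ge0.
  have -> : mass (h - \sum_(k < N) x k) - mass (h - \sum_(k < M) x k) =
      mass (\sum_(N <= k < M) x k).
    rewrite -[X in X - _](_ : mass (h - \sum_(k < M) x k + \sum_(N <= k < M) x k) = _).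
      by rewrite massD addrAC subrr add0r.
    congr mass; rewrite -!(big_mkord xpredT) (@big_cat_nat _ _ _ N 0 M)//=.
    by rewrite opprD addrA subrK.
  by apply: (@carried_mass_ge0 _ setT); apply: (csum).
pose bnd M := mass hp * mass (s M) + mass (r M) * mass hm + mass (r M) + mass (s M).
have w_bound z M : `|complex.Re ((hp * hm + F - hp - hm) z)| <= bnd M /\
    `|complex.Im ((hp * hm + F - hp - hm) z)| <= bnd M.
  (* The defect is independent of N; N = 2 M makes its three parts small. *)
  pose N := (M + M)%N.
  have we : hp * hm + F - hp - hm = (hp * hm - C N) - r N.+1 - s N.+1.
    have -> : F = \sum_(k < N.+1) a k + \sum_(k < N.+1) b k - C N by rewrite e addrK.
    by rewrite /r /s; ring.
  have mE : mass (hp * hm - C N) <= mass hp * mass (s M) + mass (r M) * mass hm.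
    rewrite -(massM _ chp) -(massM _ (cr M)) -massD -subr_ge0.
    have -> : mass (hp * s M + r M * hm) - mass (hp * hm - C N) =
        mass (C N - (hp - r M) * (hm - s M) + r M * s M).
      rewrite -[X in X - _](_ : mass (C N - (hp - r M) * (hm - s M) + r M * s M
        + (hp * hm - C N)) = _); first by rewrite massD addrK.
      by congr mass; ring.
    by apply: (@carried_mass_ge0 _ setT); apply: (cD); [exact: cC|exact: cM].
  have rN : mass (r N.+1) <= mass (r M) by apply: decr => //; rewrite /N -addnS leq_addr.
  have sN : mass (s N.+1) <= mass (s M) by apply: decr => //; rewrite /N -addnS leq_addr.
  have [e1 e2] := carried_bound z (ce N); have [r1 r2] := carried_bound z (cr N.+1).
  have [s1 s2] := carried_bound z (cs N.+1).
  have split3 (x y t u v w : R) : `|x| <= u -> `|y| <= v -> `|t| <= w ->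
      `|x - y - t| <= u + v + w.
    move=> hx hy ht; rewrite (le_trans (ler_normB _ _))// lerD//.
    by rewrite (le_trans (ler_normB _ _))// lerD.
  have bE : mass (hp * hm - C N) + mass (r N.+1) + mass (s N.+1) <= bnd M.
    by rewrite /bnd !lerD.
  have Re3 (u v w : R[i]) : complex.Re (u - v - w) = complex.Re u - complex.Re v - complex.Re w.
    by case: u v w => ? ? [] ? ? [].
  have Im3 (u v w : R[i]) : complex.Im (u - v - w) = complex.Im u - complex.Im v - complex.Im w.
    by case: u v w => ? ? [] ? ? [].
  rewrite we; split; apply: le_trans bE.
  - rewrite [X in complex.Re X](_ : _ = (hp * hm - C N) z - r N.+1 z - s N.+1 z)//.
    by rewrite Re3; exact: split3.
  - rewrite [X in complex.Im X](_ : _ = (hp * hm - C N) z - r N.+1 z - s N.+1 z)//.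
    by rewrite Im3; exact: split3.
have bnd0 : bnd M @[M --> \oo] --> (0 : R).
  rewrite [X in _ --> X](_ : 0 = mass hp * 0 + 0 * mass hm + 0 + 0).
  2: by rewrite mulr0 mul0r !addr0.
  by apply: cvgD => //; apply: cvgD => //; apply: cvgD; [apply: cvgMr|apply: cvgMl].
have small (x : R) : (forall M, `|x| <= bnd M) -> x = 0.
  move=> xb; apply/eqP; rewrite -normr_le0; apply: (ler_cvg_to _ bnd0); last exact: nearW xb.
  exact: cvg_cst.
have w0 : hp * hm + F - hp - hm = 0.
  apply/funext => z; apply/eqP; rewrite eq_complex.
  have -> := small _ (fun M => (w_bound z M).1).
  by have -> := small _ (fun M => (w_bound z M).2); rewrite eqxx.
by apply/eqP; rewrite -subr_eq0 opprD addrA [F + _]addrC w0.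
Qed.

End cauchy_product.

(** * Rigidity of the factorisation *)

Section rigidity.
Variable R : realType.
Implicit Types (k l n : {finite_measure set R -> \bar R}) (z : R).

Lemma massT k : mass (cft k setT id) = fine (k setT).
Proof. by rewrite /mass cft0. Qed.

(** A deficit on B would have to be made up for on the complement of B. *)
Lemma eq_finite_measure k l :
  (forall B, measurable B -> (l B <= k B)%E) -> k setT = l setT ->
  forall B, measurable B -> k B = l B.
Proof.
move=> lk kl B mB; apply/eqP; rewrite eq_le lk// andbT.
have mCB := measurableC mB.
have tot (m : {finite_measure set R -> \bar R}) : m setT = (m B + m (~` B))%E.
  by rewrite -measureU ?setUv ?setICr.
have := kl; rewrite !tot => e.
have lfin : l (~` B) \is a fin_num by exact: fin_num_measure.
rewrite -(leeD2rE _ _ lfin) -e leeD2l//; exact: lk.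
Qed.

(** Since n is a probability and the transform is 1 at z, 1 - cos (z x) has
    integral 0.  It dominates 1 - cos (2 z x) and sin (2 z x) - 2 sin (z x) up to
    constant factors, so these integrate to 0 as well. *)
Lemma cft_double n z : n setT = 1%E -> cft n setT id z = 1 ->
  cft n setT id (2 * z) = 1.
Proof.
move=> nT nz; have [re im] : \int[n]_x cos (z * x) = 1 /\ \int[n]_x sin (z * x) = 0.
  by case: nz.
have mid := @measurable_id _ R setT.
have ic y := @cos_integrable _ _ _ n _ _ y measurableT mid.
have is_ y := @sin_integrable _ _ _ n _ _ y measurableT mid.
have i1 : n.-integrable setT (EFin \o (cst 1 : R -> R)).
  by apply: (bounded_integrable 1) => // x; rewrite normr1.
have one : \int[n]_x (1 : R) = 1 by rewrite Rintegral_cst// mul1r; exact: (congr1 fine nT).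
have zero : \int[n]_x (1 - cos (z * x)) = 0.
  by rewrite (RintegralB _ i1 (ic z))// one re subrr.
have i1c : n.-integrable setT (EFin \o (fun x => 1 - cos (z * x))).
  by have := integrableB measurableT i1 (ic z).
have null (u : R -> R) : n.-integrable setT (EFin \o u) ->
    (forall x, `|u x| <= 4 * (1 - cos (z * x))) -> \int[n]_x u x = 0.
  move=> iu ub; apply/eqP; rewrite -normr_le0 (le_trans (le_normr_Rintegral measurableT iu))//.
  have i4 := integrableZl measurableT 4 i1c.
  rewrite (le_trans (le_Rintegral measurableT (integrable_norm iu) i4 (fun x _ => ub x)))//.
  by rewrite RintegralZl// zero mulr0.
have e2 x : 2 * z * x = (z * x) *+ 2 by rewrite mulr2n; ring.
have re2 : \int[n]_x (1 - cos (2 * z * x)) = 0.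
  apply: null => [|x]; first by have := integrableB measurableT i1 (ic (2 * z)).
  have := cos_le1 (z * x); have := cos_geN1 (z * x); rewrite e2 cos_mulr2n.
  set t := cos _ => t1 t2.
  have -> : 1 - (t ^+ 2 *+ 2 - 1) = 2 * ((1 - t) * (1 + t)) by rewrite mulr2n; ring.
  have t01 : 0 <= 1 - t by rewrite subr_ge0.
  have t02 : 0 <= 1 + t by rewrite addrC -lerBlDr sub0r.
  rewrite ger0_norm ?mulr_ge0//; rewrite -subr_ge0.
  have -> : 4 * (1 - t) - 2 * ((1 - t) * (1 + t)) = 2 * ((1 - t) * (1 - t)) by ring.
  by rewrite !mulr_ge0.
have im2 : \int[n]_x (sin (2 * z * x) - 2 * sin (z * x)) = 0.
  apply: null => [|x].
    by have := integrableB measurableT (is_ (2 * z)) (integrableZl measurableT 2 (is_ z)).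
  have := cos_le1 (z * x); have := sin_max (z * x); rewrite e2 sin_mulr2n.
  have -> : (cos (z * x) * sin (z * x)) *+ 2 - 2 * sin (z * x) =
    - 2 * (1 - cos (z * x)) * sin (z * x) by rewrite mulr2n; ring.
  set s := sin _; set t := cos _ => s1 t1; rewrite !normrM (ger0_norm (x := 1 - t)) ?subr_ge0//.
  have t0 : 0 <= 1 - t by rewrite subr_ge0.
  by rewrite normrN normr_nat (@le_trans _ _ (2 * (1 - t)))// ?ler_piMr ?mulr_ge0//; lra.
move: re2; rewrite (RintegralB _ i1 (ic _))// one => /eqP; rewrite subr_eq0 => /eqP re2.
move: im2; rewrite RintegralB//; last exact: integrableZl (is_ z).
rewrite RintegralZl// im mulr0 subr0 => im2.
by rewrite /cft -re2 im2.
Qed.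

(** Dyadic points suffice because [cft_double] propagates from z / 2 to z. *)
Lemma cft_continuous0 k z :
  complex.Re (cft k setT id (z / 2 ^+ j)) @[j --> \oo] --> mass (cft k setT id).
Proof.
have mid := @measurable_id _ R setT.
rewrite massT /cft /=.
have lim : (\int[k]_x (cos (z / 2 ^+ j * x))%:E)%E @[j --> \oo] --> k setT.
  have <- : (\int[k]_x cst 1%:E x)%E = k setT by rewrite integral_cst// mul1e.
  apply: (@dominated_cvg _ _ _ k setT _ _ _ (cst 1%:E)) => //.
  - by move=> j; exact: measurable_int (cos_integrable k (z / 2 ^+ j) measurableT mid).
  - move=> x _; apply: cvg_EFin; first exact: nearW.
    rewrite [X in _ --> X](_ : _ = cos 0); last by rewrite cos0.
    apply: continuous_cvg; first exact: continuous_cos.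
    rewrite (_ : (fun j => _) = (fun j => z * x * 2^-1 ^+ j)).
      rewrite -[X in _ --> X](mulr0 (z * x)); apply: cvgMr; apply: cvg_expr.
      by rewrite ger0_norm// invf_lt1// ltr1n.
    by apply/funext => j; rewrite exprVn mulrAC.
  - by apply: (@bounded_integrable _ _ _ k setT (cst 1) 1) => // ?; rewrite normr1.
  - by move=> j x _; rewrite abse_EFin lee_fin cos_max.
apply: fine_cvg; rewrite fineK//; exact: fin_num_measure.
Qed.

(** The difference of transforms tends to a nonzero number along z / 2 ^ j, so
    the transform of n is 1 at one of these points, and at z after j doublings. *)
Lemma cft_eq1 k l n : mass (cft k setT id) != mass (cft l setT id) ->
  (cft k setT id - cft l setT id) * (1 - cft n setT id) = 0 -> n setT = 1%E ->
  cft n setT id = 1.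
Proof.
move=> kl e nT; apply/funext => z.
have [j nj] : exists j, cft n setT id (z / 2 ^+ j) = 1.
  apply: contrapT => /forallNP nj; move/eqP: kl; apply.
  rewrite -(cvg_lim (@Rhausdorff R) (@cft_continuous0 k z)); apply: cvg_lim => //.
  rewrite (_ : (fun j => _) = (fun j => complex.Re (cft l setT id (z / 2 ^+ j)))).
    exact: cft_continuous0.
  apply/funext => j; congr complex.Re; apply/eqP; rewrite -subr_eq0.
  have := congr1 (@^~ (z / 2 ^+ j)) e => /eqP.
  rewrite mulf_eq0 => /orP[//|/eqP nj0].
  by case: (nj j); apply/esym/eqP; rewrite -subr_eq0; exact/eqP.
elim: j z nj => [|j IHj] z; first by rewrite expr0 divr1.
rewrite exprS invfM mulrA => /IHj e2.
rewrite -[z](@divfK _ 2)// mulrC; exact: cft_double.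
Qed.

(** Two factorisations of the same 1 - F, one dominated by the other, agree.
    The mass of the difference e splits into two nonnegative terms, which both
    vanish; a strict loss of mass on one side then forces a factor equal to 1 on
    the other side by [cft_eq1]. *)
Lemma factors_eq k k' l l' (F : R -> R[i]) :
  let p := cft k setT id in let q := cft k' setT id in
  let h := cft l setT id in let g := cft l' setT id in
  (k setT <= 1)%E -> (k' setT <= 1)%E ->
  (forall B, measurable B -> (l B <= k B)%E) ->
  (forall B, measurable B -> (l' B <= k' B)%E) ->
  F + p * q = p + q -> F + h * g = h + g -> F <> 1 -> h <> 1 ->
  (forall B, measurable B -> k B = l B) /\ (forall B, measurable B -> k' B = l' B).
Proof.
move=> p q h g k1 k'1 lk l'k' Fpq Fhg F1 h1.
have eFpq : (1 - p) * (1 - q) = 1 - F.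
  by have -> : F = p + q - p * q by [rewrite -Fpq addrK]; ring.
have eFhg : (1 - h) * (1 - g) = 1 - F.
  by have -> : F = h + g - h * g by [rewrite -Fhg addrK]; ring.
have fin (m : {finite_measure set R -> \bar R}) : (m setT = (mass (cft m setT id))%:E)%E.
  by rewrite massT fineK// fin_num_measure.
have car (m : {finite_measure set R -> \bar R}) : carried setT (cft m setT id).
  by exists m => //; rewrite setCT measure0.
have [P1 Q1 HP GQ] : [/\ mass p <= 1, mass q <= 1, mass h <= mass p & mass g <= mass q].
  by split; rewrite -lee_fin -!fin//; [exact: lk|exact: l'k'].
have e : (p - h) * (1 - g) + (1 - p) * (q - g) = 0.
  have -> : (p - h) * (1 - g) + (1 - p) * (q - g) =
    (1 - h) * (1 - g) - (1 - p) * (1 - q) by ring.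
  by rewrite eFpq eFhg subrr.
have e0 : (mass p - mass h) * (1 - mass g) + (1 - mass p) * (mass q - mass g) = 0.
  have := congr1 (@^~ 0) e => /=.
  rewrite [X in X = _](_ : _ = (p 0 - h 0) * (1 - g 0) + (1 - p 0) * (q 0 - g 0))//.
  have [p0 q0] : p 0 = (mass p)%:C%C /\ q 0 = (mass q)%:C%C.
    by split; [exact: carried_massE (car k)|exact: carried_massE (car k')].
  have [h0 g0] : h 0 = (mass h)%:C%C /\ g 0 = (mass g)%:C%C.
    by split; [exact: carried_massE (car l)|exact: carried_massE (car l')].
  rewrite p0 q0 h0 g0.
  move=> /(congr1 (@complex.Re R)) /=; rewrite !subr0 !mulr0 ?mul0r !subr0.
  by [].
have t1 : 0 <= (mass p - mass h) * (1 - mass g) by apply: mulr_ge0; lra.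
have t2 : 0 <= (1 - mass p) * (mass q - mass g) by apply: mulr_ge0; lra.
have {t1} z1 : (mass p - mass h) * (1 - mass g) = 0 by lra.
have {t2 e0} z2 : (1 - mass p) * (mass q - mass g) = 0 by lra.
have eqm (m m' : {finite_measure set R -> \bar R}) :
    (forall B, measurable B -> (m' B <= m B)%E) ->
    mass (cft m setT id) = mass (cft m' setT id) ->
    forall B, measurable B -> m B = m' B.
  by move=> mm' em; apply: eq_finite_measure => //; rewrite !fin em.
have kl : mass p = mass h.
  apply/eqP; apply: contrapT => /negP ph.
  have G1 : mass g = 1.
    by move/eqP: z1; rewrite mulf_eq0 !subr_eq0 (negPf ph) => /eqP.
  have qg : q = g by apply: eq_cft_measure; apply: eqm => //; apply/eqP; rewrite eq_le GQ G1 Q1.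
  have gE : g = 1.
    apply: (cft_eq1 ph); last by rewrite fin G1.
    by move: e; rewrite qg subrr mulr0 addr0.
  apply: F1; move: eFhg; rewrite gE subrr mulr0 => /eqP.
  by rewrite eq_sym subr_eq0 eq_sym => /eqP.
have klB := eqm _ _ lk kl; split=> //; apply: eqm => //.
have ph : p = h by exact: eq_cft_measure.
apply/eqP; apply: contrapT => /negP qg.
have P1' : mass p = 1.
  by move/eqP: z2; rewrite mulf_eq0 !subr_eq0 (negPf qg) orbF => /eqP.
apply: h1; apply: (cft_eq1 qg); last by rewrite fin -/h -kl P1'.
by move: e; rewrite ph subrr mul0r add0r mulrC.
Qed.

End rigidity.

(** * The exits of a random walk from a set *)

Section walk.
Context d (Omega : measurableType d) (R : realType) (P : probability Omega R).
Variable X : nat -> {RV P >-> R}.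
Implicit Types (A B C : set R) (n k : nat).

(** [stay A n] constrains the times 1, ..., n, and [exit A n] is the event that
    the walk first leaves A at time n.+1. *)
Definition stay A n : set Omega := \bigcap_(k in `I_n) (X k.+1 @^-1` A).

Definition exit A n : set Omega := stay A n `&` ~` (X n.+1 @^-1` A).

Lemma preimage_measurable (Y : {RV P >-> R}) A : measurable A -> measurable (Y @^-1` A).
Proof. by move=> mA; rewrite -[X in measurable X]setTI; exact: measurable_funPT. Qed.

Lemma stay_measurable A n : measurable A -> measurable (stay A n).
Proof.
by move=> mA; apply: bigcap_measurableType => k _; exact: preimage_measurable.
Qed.

Lemma exit_measurable A n : measurable A -> measurable (exit A n).
Proof.
move=> mA; apply: measurableI; first exact: stay_measurable.
by apply: measurableC; exact: preimage_measurable.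
Qed.

Lemma stayS A n : stay A n.+1 = stay A n `&` X n.+1 @^-1` A.
Proof.
apply/seteqP; split=> [w h|w [h An] k].
  by split=> [k kn|]; apply: h => /=; [exact: ltnW|exact: ltnSn].
by rewrite /= ltnS leq_eqVlt => /orP[/eqP->//|]; exact: h.
Qed.

Section increments.
Hypothesis rw : random_walk X.

(** The pi-system of cylinders on the first n increments; it generates the past
    of the walk up to time n. *)
Let rectangles n : set (set Omega) :=
  [set S | exists2 B : nat -> set R, forall i, measurable (B i) &
    S = \bigcap_(i in `I_n) (increment X i @^-1` B i)].

Let rect_prob n (B : nat -> set R) : (forall i, measurable (B i)) ->
  P (\bigcap_(i in `I_n.+1) (increment X i @^-1` B i)) =
  (P (increment X n @^-1` B n) *
   P (\bigcap_(i in `I_n) (increment X i @^-1` B i)))%E.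
Proof.
move=> mB; have [_ ind _] := rw.
pose J := [fset x in iota 0 n]%fset.
have JE : [set` J] = `I_n.
  by apply/seteqP; split=> i /=; rewrite in_fset /= mem_iota add0n.
have J'E : [set` (n |` J)%fset] = `I_n.+1.
  by apply/seteqP; split=> i /=; rewrite in_fset1U in_fset /= mem_iota add0n -leq_eqVlt.
rewrite -J'E -JE !ind// big_fsetU1//=.
by rewrite in_fset /= mem_iota add0n ltnn.
Qed.

(** Both sides are finite measures in S that agree on cylinders. *)
Let past_independent n C S : measurable C -> <<s rectangles n >> S ->
  P (S `&` increment X n @^-1` C) = (P S * P (increment X n @^-1` C))%E.
Proof.
move=> mC sS; have mIC := preimage_measurable (increment X n) mC.
have pfin : P (increment X n @^-1` C) \is a fin_num by exact: fin_num_measure.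
pose r : {nonneg R} := NngNum (fine_ge0 (measure_ge0 P (increment X n @^-1` C))).
have e : mrestr P mIC S = mscale r P S.
  apply: (g_sigma_algebra_measure_unique (rectangles n) _ (fun=> setT)) => //.
  - move=> _ [B mB ->]; apply: bigcap_measurableType => i _; exact: preimage_measurable.
  - by move=> i; exists (fun=> setT) => //; apply/seteqP; split.
  - by apply/seteqP; split=> // w _; exists 0%N.
  - move=> _ _ [B mB ->] [B' mB' ->]; exists (fun i => B i `&` B' i).
      by move=> i; exact: measurableI.
    by rewrite -bigcapI; apply: eq_bigcapr => i _; rewrite preimage_setI.
  - move=> _ [B mB ->]; pose B' i := if i == n then C else B i.
    have mB' i : measurable (B' i) by rewrite /B'; case: ifP.
    have low : \bigcap_(i in `I_n) (increment X i @^-1` B' i) =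
        \bigcap_(i in `I_n) (increment X i @^-1` B i).
      by apply: eq_bigcapr => i /=; rewrite /B' => /ltn_eqF ->.
    have := rect_prob n mB'; rewrite low {2}/B' eqxx.
    have -> : \bigcap_(i in `I_n.+1) (increment X i @^-1` B' i) =
        \bigcap_(i in `I_n) (increment X i @^-1` B i) `&` increment X n @^-1` C.
      rewrite -low; apply/seteqP; split=> [w h|w [h hC] i /=].
        split=> [i /= lin|]; first by apply: h; exact: ltnW.
        by have := h n (ltnSn n); rewrite /B' /= eqxx.
      rewrite ltnS leq_eqVlt => /orP[/eqP ->|]; last exact: h.
      by rewrite /B' eqxx.
    by move=> h; rewrite [LHS]h -[X in (X * _)%E]fineK.
  - by move=> k; rewrite /= /mrestr setTI ltey_eq fin_num_measure.
by rewrite muleC -[X in (X * _)%E]fineK//; exact: e.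
Qed.

Let past_measurable n k C : (k <= n)%N -> measurable C ->
  <<s rectangles n >> (X k @^-1` C).
Proof.
pose T := g_sigma_algebraType (rectangles n).
have mI i : (i < n)%N -> measurable_fun (setT : set T) (increment X i : T -> R).
  move=> lin _ B mB; rewrite setTI; apply: sub_sigma_algebra.
  exists (fun j => if j == i then B else setT); first by move=> j; case: ifP.
  apply/seteqP; split=> [w Bw j _ /=|w /(_ i lin) /=]; last by rewrite eqxx.
  by case: eqP => // ->.
have mX j : (j <= n)%N -> measurable_fun (setT : set T) (X j : T -> R).
  elim: j => [_|j IHj jn].
    rewrite (_ : (X 0%N : T -> R) = cst 0); first exact: measurable_cst.
    by apply/funext => w; have [-> _ _] := rw.
  rewrite (_ : (X j.+1 : T -> R) = (fun w : T => X j w + increment X j w)).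
    by apply: measurable_funD; [exact: IHj (ltnW jn)|exact: mI].
  by apply/funext => w /=; rewrite addrC subrK.
by move=> kn mC; have := mX k kn measurableT C mC; rewrite setTI.
Qed.

Lemma stay_independent A n B C : measurable A -> measurable B -> measurable C ->
  P (stay A n `&` (X n @^-1` B `&` increment X n @^-1` C)) =
  (P (stay A n `&` X n @^-1` B) * P (increment X n @^-1` C))%E.
Proof.
move=> mA mB mC; rewrite setIA past_independent//.
pose T := g_sigma_algebraType (rectangles n).
apply: (@measurableI _ T); last exact: past_measurable.
by apply: (@bigcap_measurableType _ T) => k kn; exact: past_measurable.
Qed.

Definition stay_transform A n := cft P (stay A n) (X n).
Definition exit_transform A n := cft P (exit A n) (X n.+1).

Lemma walk_exits A : measurable A ->
  exits (carried A) (carried (~` A)) (cft P setT (X 1%N))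
    (stay_transform A) (exit_transform A).
Proof.
move=> mA; have [X0 _ same] := rw.
have mX n : measurable_fun setT (X n) by exact: measurable_funPT.
split.
- apply/funext => z; rewrite /stay_transform /cft.
  have -> : stay A 0 = setT by apply/seteqP; split.
  under eq_Rintegral do rewrite X0 mulr0 cos0.
  under [Y in (_ +i* Y)%C]eq_Rintegral do rewrite X0 mulr0 sin0.
  rewrite !Rintegral_cst// mul0r mul1r.
  by apply/eqP; rewrite eq_complex /= probability_setT !eqxx.
- move=> n.
  have -> : cft P setT (X 1%N) = cft (distribution P (increment X n)) setT id.
    rewrite (@eq_cft_measure _ _ _ _ (image_measure P measurableT (increment X 0))).
      rewrite cft_image; last exact: measurable_id.
      congr (cft P setT _); apply/funext => w.
      by rewrite [RHS](_ : _ = X 1%N w - X 0%N w)// X0 subr0.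
    by move=> B mB; rewrite [RHS]image_measureE setTI; exact: same.
  rewrite -(@cft_independent _ _ _ P _ (X n) (increment X n)); first last.
  + by move=> B C mB mC; exact: stay_independent.
  + exact: stay_measurable.
  apply/funext => z; rewrite [RHS](_ : _ = stay_transform A n.+1 z + exit_transform A n z)//.
  rewrite /stay_transform /exit_transform -cft_setU.
  + rewrite stayS /exit -setIUr setUv setIT; congr (cft _ _ _ z).
    by apply/funext => w /=; rewrite addrC subrK.
  + exact: stay_measurable.
  + exact: exit_measurable.
  + exact: mX.
  + by rewrite stayS /exit setIACA setICr setI0.
- move=> n; apply: carried_cft; [exact: stay_measurable|exact: mX|].
  by rewrite stayS => w [].
- by move=> n; apply: carried_cft; [exact: exit_measurable|exact: mX|move=> w []].
Qed.

End increments.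
End walk.

(** * Laws of exit positions and of killed variables *)

(** Y is the exit position, and D the event that an exit takes place.  They are
    kept abstract because H^{-,w} has to be negated to become such a Y. *)
Section exit_law.
Context d (Omega : measurableType d) (R : realType) (P : probability Omega R).
Variable X : nat -> {RV P >-> R}.
Variables (A : set R) (D : set Omega) (Y : {mfun Omega >-> R}).
Hypothesis mA : measurable A.
Hypothesis exit_cover : D = \bigcup_n exit X A n.
Hypothesis exit_value : forall n w, exit X A n w -> Y w = X n.+1 w.

Let U N := \bigcup_(n in `I_N) exit X A n.

Let mU N : measurable (U N).
Proof. by apply: bigcup_measurable => n _; exact: exit_measurable. Qed.

Let mD : measurable D.
Proof. by rewrite exit_cover; apply: bigcup_measurable => n _; exact: exit_measurable. Qed.

Let UD N : U N `<=` D.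
Proof. by rewrite exit_cover => w [n _ ?]; exists n. Qed.

Let mY : measurable_fun setT Y.
Proof. exact: measurable_funPT. Qed.

Let exit_disjoint N : U N `&` exit X A N = set0.
Proof.
apply/seteqP; split=> // w [[n /= nN [_ Xn]] [XN _]].
by apply: Xn; exact: XN.
Qed.

Let US N : U N.+1 = U N `|` exit X A N.
Proof. by rewrite /U IIS bigcup_setU bigcup_set1. Qed.

Let exit_sum N : \sum_(k < N) exit_transform X A k = cft P (U N) Y.
Proof.
elim: N => [|N IHN].
  rewrite big_ord0; apply/funext => z.
  by rewrite /U II0 bigcup_set0 /cft !Rintegral_set0.
rewrite big_ord_recr /= IHN; apply/funext => z; rewrite US cft_setU//; last first.
  exact: exit_measurable.
congr (_ + _); rewrite /exit_transform /cft.
by congr (_ +i* _)%C; apply: eq_Rintegral => w /set_mem /exit_value ->.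
Qed.

Let rest_law N : cft P D Y - \sum_(k < N) exit_transform X A k = cft P (D `\` U N) Y.
Proof.
have mDU : measurable (D `\` U N) by exact: measurableD.
apply/eqP; rewrite subr_eq exit_sum; apply/eqP/funext => z.
rewrite [RHS](_ : _ = cft P (D `\` U N) Y z + cft P (U N) Y z)//.
have dDU : (D `\` U N) `&` U N = set0 by apply/seteqP; split=> // w [[]].
rewrite -(cft_setU _ _ mDU (mU N) mY dDU); congr (cft _ _ _ z).
by apply/seteqP; split=> w; [have [|] := pselect (U N w); [right|left]|case=> [[]//|/UD]].
Qed.

Let exit_cvg B : measurable B ->
  P (U N `&` Y @^-1` B) @[N --> \oo] --> P (D `&` Y @^-1` B).
Proof.
move=> mB; have mYB : measurable (Y @^-1` B).
  by rewrite -[X in measurable X]setTI; exact: mY.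
have -> : D `&` Y @^-1` B = \bigcup_N (U N `&` Y @^-1` B).
  rewrite -setI_bigcupl; congr (_ `&` _); rewrite exit_cover.
  apply/seteqP; split=> w [n _]; last by move=> [k _ ?]; exists k.
  by exists n.+1 => //; exists n => /=.
apply: nondecreasing_cvg_mu.
- by move=> N; exact: measurableI.
- by apply: bigcupT_measurable => N; exact: measurableI.
- move=> n m nm; apply/subsetPset; apply: setSI => w [k /= kn ?]; exists k => //=.
  exact: leq_trans nm.
Qed.

Lemma exit_rest_carried N :
  carried setT (cft P D Y - \sum_(k < N) exit_transform X A k).
Proof. by rewrite rest_law; apply: carried_cft => //; exact: measurableD. Qed.

Lemma exit_rest_cvg0 :
  mass (cft P D Y - \sum_(k < N) exit_transform X A k) @[N --> \oo] --> 0.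
Proof.
rewrite (_ : (fun N => _) = (fun N => fine (P D) - fine (P (U N)))); last first.
  apply/funext => N; rewrite rest_law /mass cft0; last exact: measurableD.
  rewrite /= measureD//; last by rewrite ltey_eq fin_num_measure.
  by rewrite setIidr ?fineB ?fin_num_measure//; exact: UD.
rewrite -[X in _ --> X](subrr (fine (P D))); apply: cvgB; first exact: cvg_cst.
have := exit_cvg measurableT; rewrite preimage_setT setIT.
under eq_fun do rewrite setIT.
by move=> h; apply: fine_cvg; rewrite fineK// fin_num_measure.
Qed.

(** Positivity of the differences yields, through uniqueness of transforms, a
    setwise bound for the law of the exits before time N; let N grow. *)
Lemma exit_law_le (k : {finite_measure set R -> \bar R}) :
  (forall N, carried setT (cft k setT id - \sum_(n < N) exit_transform X A n)) ->
  forall B, measurable B -> (P (D `&` Y @^-1` B) <= k B)%E.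
Proof.
move=> ck B mB.
apply: (lee_cvg_to (exit_cvg mB)); first exact: cvg_cst.
apply: nearW => N; have [c _ e] := ck N.
rewrite /= (@cft_inj _ k (measure_sum (image_measure P (mU N) Y) c) _ _ mB).
  by rewrite [leRHS]measure_sumE [X in (X + _)%E]image_measureE leeDl.
apply/funext => z; rewrite cft_measure_add//.
have := congr1 (@^~ z) e => /eqP; rewrite exit_sum cft_image; last exact: measurable_id.
by rewrite [X in X == _](_ : _ = cft k setT id z - cft P (U N) Y z)// subr_eq addrC => /eqP.
Qed.

End exit_law.

Section killed.
Context d (Omega : measurableType d) (R : realType) (P : probability Omega R).
Variable V : {RV P >-> killed R}.

Definition alive : set Omega := V @^-1` [set~ Delta].

Definition value (w : Omega) : R := if V w is Some x then x else 0.

Lemma some_measurable (B : set R) : measurable B ->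
  measurable [set w | exists2 x, B x & V w = Some x].
Proof.
move=> mB; rewrite (_ : [set w | _] = V @^-1` (Some @` B)); last first.
  by apply/seteqP; split=> w [x Bx e]; exists x.
rewrite -[X in measurable X]setTI; apply: measurable_funPT => //.
rewrite /measurable /= /killed_measurable /=.
rewrite (_ : _ @^-1` _ = B)//; apply/seteqP; split=> x /=; last by move=> ?; exists x.
by move=> [y By [<-]].
Qed.

Lemma alive_measurable : measurable alive.
Proof.
rewrite (_ : alive = [set w | exists2 x, setT x & V w = Some x]); first exact: some_measurable.
apply/seteqP; split=> w; rewrite /alive /=; last by move=> [x _ ->].
by case: (V w) => // x _; exists x.
Qed.

Lemma value_measurable : measurable_fun setT value.
Proof.
move=> _ B mB; rewrite setTI.
rewrite (_ : value @^-1` B = [set w | exists2 x, B x & V w = Some x] `|`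
    (if `[< B 0 >] then ~` alive else set0)).
  apply: measurableU; first exact: some_measurable.
  by case: ifP => // _; apply: measurableC; exact: alive_measurable.
apply/seteqP; split=> w; rewrite /value /alive /preimage /=.
  by case E: (V w) => [x|] B0; [left; exists x|right; rewrite asboolT// => /(_ E)].
case=> [[x Bx ->]//|]; case: asboolP => // B0 /= nV.
by case: (V w) nV => // x [].
Qed.

HB.instance Definition _ := isMeasurableFun.Build _ _ _ _ value value_measurable.

Lemma Cexpectation_kill_ext (phi : R -> R) z :
  Cexpectation P (fun w => kill_ext (fun v => expi (z * phi v)) (V w)) =
  cft P alive (phi \o value) z.
Proof.
have part (G : R[i] -> R) (c : R -> R) : G 0 = 0 -> (forall t, G (expi t) = c t) ->
    (\int[P]_w (G (kill_ext (fun v => expi (z * phi v)) (V w)))%:E =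
     \int[P]_(w in alive) (c (z * (phi \o value) w))%:E)%E.
  move=> G0 Gc; rewrite [RHS]integral_mkcond; apply: eq_integral => w _.
  rewrite patchE; case E: (V w) => [x|].
    rewrite mem_set; last by rewrite /alive /preimage /= E.
    by rewrite /value /= E; congr EFin; exact: Gc.
  rewrite memNset; first by congr EFin; exact: G0.
  by rewrite /alive /preimage /= E; apply.
by rewrite /Cexpectation unlock !(part _ _ erefl (fun=> erefl)).
Qed.

End killed.

(** The mass of the cemetery is recovered by complementation. *)
Lemma killed_eq_dist d1 d2 (O1 : measurableType d1) (O2 : measurableType d2)
    (R : realType) (P : probability O1 R) (Q : probability O2 R)
    (V : {RV P >-> killed R}) (W : {RV Q >-> killed R}) :
  (forall B, measurable B ->
    P (alive V `&` value V @^-1` B) = Q (alive W `&` value W @^-1` B)) ->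
  eq_dist P Q V W.
Proof.
move=> e A mA; rewrite /distribution /pushforward.
have dec d (O : measurableType d) (M : probability O R) (Z : {RV M >-> killed R}) :
    M (Z @^-1` A) = (M (alive Z `&` value Z @^-1` (Some @^-1` A)) +
      (if `[< A Delta >] then 1 - M (alive Z `&` value Z @^-1` setT) else 0))%E.
  have mZ := alive_measurable Z.
  have mZA : measurable (alive Z `&` value Z @^-1` (Some @^-1` A)).
    apply: measurableI => //; rewrite -[X in measurable X]setTI.
    exact: value_measurable.
  have -> : Z @^-1` A = (alive Z `&` value Z @^-1` (Some @^-1` A)) `|`
      (if `[< A Delta >] then ~` alive Z else set0).
    apply/seteqP; split=> w; rewrite /alive /value /preimage /=.
      by case E: (Z w) => [x|] AE; [left|right; rewrite asboolT// => /(_ E)].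
    case=> [[]|]; first by case: (Z w).
    by case: asboolP => // AD /contrapT ->.
  rewrite preimage_setT setIT; case: asboolP => AD.
    rewrite measureU//; [|exact: measurableC|by rewrite setIAC setICr set0I].
    by congr (_ + _)%E; exact: probability_setC.
  by rewrite setU0 adde0.
by rewrite !dec !e.
Qed.

(** * Ladder heights as exit positions *)

Lemma exit_first_time d (Omega : measurableType d) (R : realType)
    (P : probability Omega R) (X : nat -> {RV P >-> R}) (A : set R) (p : pred nat) w :
  p 0%N = false -> (forall n, p n.+1 <-> ~ A (X n.+1 w)) ->
  forall n, exit X A n w <-> first_time p = Some n.+1.
Proof.
move=> p0 pS n; rewrite first_time_Some; split=> [[st ex]|[/pS ex st]].
  split=> [|[_|k]]; [exact/pS|by rewrite p0|].
  by rewrite ltnS => kn; apply/negP => /pS; apply; exact: st.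
split=> // k /= kn; apply: contrapT => /pS.
by apply/negP; exact: st.
Qed.

Section ladder_exits.
Context d (Omega : measurableType d) (R : realType) (P : probability Omega R).
Variable X : nat -> {RV P >-> R}.

Let ray : set R := `]0, +oo[%classic.

Lemma rayE x : ray x <-> 0 < x.
Proof. by rewrite /ray /= in_itv /= andbT. Qed.

Lemma H_plus_exit n w : exit X (~` ray) n w <-> tau_plus X w = Some n.+1.
Proof.
apply: exit_first_time => // m /=.
by split=> [xp h|/contrapT/rayE//]; apply: h; exact/rayE.
Qed.

Lemma H_minus_exit n w : exit X ray n w <-> tau_minus_weak X w = Some n.+1.
Proof.
apply: exit_first_time => // m /=.
by rewrite leNgt; split=> [/negP xn /rayE//|h]; apply/negP => /rayE.
Qed.

Lemma tau_plus_neq0 w : tau_plus X w <> Some 0%N.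
Proof. by move=> /first_time_Some[]. Qed.

Lemma tau_minus_neq0 w : tau_minus_weak X w <> Some 0%N.
Proof. by move=> /first_time_Some[]. Qed.

Lemma alive_H_plus : alive (H_plus X : {RV P >-> killed R}) = \bigcup_n exit X (~` ray) n.
Proof.
apply/seteqP; split=> w.
  rewrite /alive /preimage /= /H_plus; case E: (tau_plus X w) => [[|n]|] // _.
    by have := tau_plus_neq0 E.
  by exists n => //; exact/H_plus_exit.
by move=> [n _ /H_plus_exit E]; rewrite /alive /preimage /= /H_plus E.
Qed.

Lemma value_H_plus n w : exit X (~` ray) n w ->
  value (H_plus X : {RV P >-> killed R}) w = X n.+1 w.
Proof. by move=> /H_plus_exit E; rewrite /value /= /H_plus E. Qed.

Lemma alive_H_minus : alive (H_minus_weak X : {RV P >-> killed R}) = \bigcup_n exit X ray n.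
Proof.
apply/seteqP; split=> w.
  rewrite /alive /preimage /= /H_minus_weak; case E: (tau_minus_weak X w) => [[|n]|] // _.
    by have := tau_minus_neq0 E.
  by exists n => //; exact/H_minus_exit.
by move=> [n _ /H_minus_exit E]; rewrite /alive /preimage /= /H_minus_weak E.
Qed.

Lemma value_H_minus n w : exit X ray n w ->
  - value (H_minus_weak X : {RV P >-> killed R}) w = X n.+1 w.
Proof. by move=> /H_minus_exit E; rewrite /value /= /H_minus_weak E opprK. Qed.

End ladder_exits.

(** A transform equal to 1 is that of the Dirac mass at 0. *)
Lemma cft_neq1 d (Omega : measurableType d) (R : realType)
    (P : probability Omega R) (Y : {RV P >-> R}) :
  ~ {ae P, forall w, Y w = 0} -> cft P setT Y <> 1.
Proof.
move=> Y0 Y1; apply: Y0.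
have m0 : measurable [set (0 : R)] by [].
have [k k0 kE] := carried1 m0 erefl.
have e : forall B, measurable B -> image_measure P measurableT Y B = k B.
  by apply: cft_inj; rewrite cft_image ?Y1 ?kE//; exact: measurable_id.
exists (Y @^-1` (~` [set 0])); split.
- by apply: preimage_measurable; exact: measurableC.
- rewrite -k0 -e; last exact: measurableC.
  by rewrite [RHS]image_measureE setTI.
- by move=> w.
Qed.

Theorem theorem3 (R : realType)
    (d : measure_display) (Omega : measurableType d) (P : probability Omega R)
    (X : nat -> {RV P >-> R})
    (dp : measure_display) (Omegap : measurableType dp)
    (Pp : probability Omegap R) (Vp : {RV Pp >-> killed R})
    (dm : measure_display) (Omegam : measurableType dm)
    (Pm : probability Omegam R) (Vm : {RV Pm >-> killed R}) :
  random_walk X ->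
  ~ {ae P, forall w, X 1%N w = 0} ->
  positive_defective Vp ->
  nonnegative_defective Vm ->
  (forall z : R,
    1 - Cexpectation P (fun w => expi (z * X 1%N w))
    = (1 - Cexpectation Pp (fun w => kill_ext (fun v => expi (z * v)) (Vp w)))
      * (1 - Cexpectation Pm
               (fun w => kill_ext (fun v => expi (- (z * v))) (Vm w)))) ->
  eq_dist Pp P Vp (H_plus X) /\ eq_dist Pm P Vm (H_minus_weak X).
Proof.
move=> rw X1 Vp0 Vm0 factor.
pose A : set R := `]0, +oo[%classic.
have mA : measurable A by exact: measurable_itv.
have mCA := measurableC mA.
have AP x : A x <-> 0 < x := rayE x.
have CAP x : (~` A) x <-> x <= 0.
  by rewrite /= leNgt; split=> [h|/negP h /AP//]; apply/negP => /AP.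
have S : splitting (carried setT) (carried A) (carried (~` A)).
  apply: carried_splitting => // x y; first by rewrite !AP; exact: addr_gt0.
  by rewrite !CAP => x0 y0; rewrite -[leRHS]addr0 lerD.
pose Hp : {RV P >-> killed R} := H_plus X.
pose Hm : {RV P >-> killed R} := H_minus_weak X.
pose kp := image_measure Pp (alive_measurable Vp) (value Vp).
pose km := image_measure Pm (alive_measurable Vm) (- (value Vm : {mfun _ >-> R})).
pose lp := image_measure P (alive_measurable Hp) (value Hp).
pose lm := image_measure P (alive_measurable Hm) (- (value Hm : {mfun _ >-> R})).
pose F := cft P setT (X 1%N).
pose p := cft kp setT id; pose q := cft km setT id.
pose h := cft lp setT id; pose g := cft lm setT id.
have mid := @measurable_id _ R setT.
have pE : p = cft Pp (alive Vp) (value Vp) by rewrite /p cft_image.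
have qE : q = cft Pm (alive Vm) (- value Vm) by rewrite /q cft_image.
have hE : h = cft P (alive Hp) (value Hp) by rewrite /h cft_image.
have gE : g = cft P (alive Hm) (- value Hm) by rewrite /g cft_image.
have Fpq : F + p * q = p + q.
  apply/funext => z; have := factor z.
  rewrite (Cexpectation_kill_ext Vp idfun) -[cft _ _ (idfun \o _) z]/(cft _ _ (value Vp) z) -pE.
  under [X in _ * (1 - Cexpectation _ X)]eq_fun do under eq_fun do rewrite -mulrN.
  rewrite (Cexpectation_kill_ext Vm -%R) -[cft _ _ (-%R \o _) z]/(cft _ _ (- value Vm) z) -qE.
  rewrite (_ : Cexpectation P _ = F z); last by rewrite /Cexpectation unlock.
  move=> e; rewrite [LHS](_ : _ = F z + p z * q z)// [RHS](_ : _ = p z + q z)//.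
  have -> : F z = 1 - (1 - p z) * (1 - q z) by rewrite -e; ring.
  by ring.
have E1 := walk_exits rw mA; have E2 := walk_exits rw mCA; rewrite setCK in E2.
have pA : carried A p.
  rewrite pE; apply: (carried_cft _ (alive_measurable Vp) (value_measurable Vp)).
  move=> w; rewrite /alive /preimage /value /=; case: (Vp0 w) => [->//|[x x0 ->] _].
  exact/AP.
have qA : carried (~` A) q.
  rewrite qE; apply: (carried_cft _ (alive_measurable Vm) (measurable_funPT _)).
  move=> w aw; apply/CAP; rewrite [leLHS](_ : _ = - value Vm w)// /value.
  move: aw; rewrite /alive /preimage /=.
  by case: (Vm0 w) => [->//|[x x0 ->] _]; rewrite oppr_le0.
have hA : carried A h.
  rewrite hE; apply: (carried_cft _ (alive_measurable Hp) (value_measurable Hp)).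
  move=> w; rewrite alive_H_plus => -[n _ ex]; rewrite (value_H_plus ex).
  by case: ex => _ /contrapT.
have Fcar : carried setT F by apply: carried_cft => //; exact: measurable_funPT.
have value_Hm n w : exit X A n w -> (- value Hm) w = X n.+1 w := @value_H_minus _ _ _ _ X n w.
have rp := exit_rest_cvg0 mCA (alive_H_plus X) (@value_H_plus _ _ _ _ X).
have rm := exit_rest_cvg0 mA (alive_H_minus X) value_Hm.
have cp := exit_rest_carried mCA (alive_H_plus X) (@value_H_plus _ _ _ _ X).
have cm := exit_rest_carried mA (alive_H_minus X) value_Hm.
have Fhg : F + h * g = h + g.
  rewrite hE gE.
  apply: (cauchy_product (a := exit_transform X (~` A)) (b := exit_transform X A)) => //.
  - by case: E2 => _ _ _ Ea n; exact: carriedW (Ea n).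
  - by case: E1 => _ _ _ Eb n; exact: carriedW (Eb n).
  - by rewrite -hE; exact: carriedW hA.
  - by apply: (carried_cft _ (alive_measurable Hm) (measurable_funPT _)).
  - by move=> N; exact: (exits_partial_sums S E1 E2).
have lk : forall B, measurable B -> (lp B <= kp B)%E.
  move=> B mB; rewrite [leLHS]image_measureE.
  apply: (exit_law_le mCA (alive_H_plus X) (@value_H_plus _ _ _ _ X)) => // N.
  apply: carriedW; apply: (exits_minorant N (splittingC S) Fcar qA pA _ E2).
  by rewrite [q * p]mulrC [q + p]addrC.
have l'k' : forall B, measurable B -> (lm B <= km B)%E.
  move=> B mB; rewrite [leLHS]image_measureE.
  apply: (exit_law_le mA (alive_H_minus X) value_Hm) => // N.
  by apply: carriedW; exact: (exits_minorant N S Fcar pA qA Fpq E1).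
have h1 : h <> 1.
  move=> h1; have c1 : carried (~` A) 1 by apply: carried1 => //; exact/CAP.
  have := carried_uniq mA hA (carried0 A) (carried0 _) c1.
  rewrite addr0 add0r => /(_ h1); rewrite h1 => /eqP; apply/negP; exact: oner_neq0.
have kp1 : (kp setT <= 1)%E.
  rewrite [leLHS]image_measureE preimage_setT setIT.
  by apply: probability_le1; exact: alive_measurable.
have km1 : (km setT <= 1)%E.
  rewrite [leLHS]image_measureE preimage_setT setIT.
  by apply: probability_le1; exact: alive_measurable.
have [kl k'l'] := factors_eq kp1 km1 lk l'k' Fpq Fhg (cft_neq1 X1) h1.
split; apply: killed_eq_dist => B mB.
  rewrite -(image_measureE Pp (alive_measurable Vp) (value Vp) B).
  by rewrite -(image_measureE P (alive_measurable Hp) (value Hp) B); exact: kl.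
have mNB : measurable (-%R @^-1` B : set R).
  by rewrite -[X in measurable X]setTI; exact: (measurable_funN mid).
have oppK (T : Type) (u : T -> R) : (fun w => - u w) @^-1` (-%R @^-1` B) = u @^-1` B.
  by apply/seteqP; split=> w /=; rewrite opprK.
rewrite -(oppK _ (value Vm)) -(oppK _ (value Hm)).
rewrite -(image_measureE Pm (alive_measurable Vm) (- (value Vm : {mfun _ >-> R}))).
rewrite -(image_measureE P (alive_measurable Hm) (- (value Hm : {mfun _ >-> R}))).
exact: k'l'.
Qed.
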